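(* Let $\Omega\subset\mathbb{C}$ be a simply connected domain. The Hamiltonian stationary conformal Lagrangian immersions $X:\Omega\to\mathbb{R}^4$ are given by solving successively three linear partial differential equations: $$(1)\ \ \Delta\beta=0,\qquad (2)\ \ \frac{\partial u}{\partial\bar z}=\frac12\frac{\partial\beta}{\partial z}L_i\bar u,\qquad (3)\ \ dX=e^{\beta L_i/2}(u\,dz+\bar u\,d\bar z),$$ for $\beta:\Omega\to\mathbb{R}$ and $u=a\epsilon+bL_i\bar\epsilon$ with $a,b:\Omega\to\mathbb{C}$ smooth. That is: if $X$ is a Hamiltonian stationary conformal Lagrangian immersion with Lagrangian angle map $\beta$, then $\beta$ satisfies (1) and (3) holds for some $u=a\epsilon+bL_i\bar\epsilon$ (with $a,b:\Omega\to\mathbb{C}$ smooth) satisfying (2); conversely, if $\beta$ satisfies (1) and $u=a\epsilon+bL_i\bar\epsilon$ (with $a,b:\Omega\to\mathbb{C}$ smooth) satisfies (2), then (3) can be integrated to a map $X:\Omega\to\mathbb{R}^4$, which is a (weakly) conformal Hamiltonian stationary Lagrangian map with Lagrangian angle map $\beta$, and is an immersion where $u\neq0$. Moreover, for a given harmonic $\beta$, the set of weakly conformal solutions (with Lagrangian angle map equal to $\beta$ up to an additive constant) is the $\mathcal{G}$-orbit $\{g\circ X: g\in\mathcal{G},X\in V\}$ of a real vector space $V$ of maps $\Omega\to\mathbb{R}^4$.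
   Context: $\mathbb{R}^4$ has its standard inner product $\langle\cdot,\cdot\rangle$, standard basis $\epsilon_1,\dots,\epsilon_4$ and symplectic form $\omega=dx^1\wedge dx^2+dx^3\wedge dx^4$. The complex structure is $L_i(x^1,x^2,x^3,x^4)=(-x^2,x^1,-x^4,x^3)$ (so $\omega(x,y)=\langle L_ix,y\rangle$), extended complex-linearly to $\mathbb{C}^4$. $\epsilon=\frac12(1,0,-i,0)^T$, $\bar\epsilon=\frac12(1,0,i,0)^T$. $\mathcal{G}$ is the group of affine transformations $x\mapsto Gx+T$ of $\mathbb{R}^4$ with $T\in\mathbb{R}^4$ and $G\in SO(4)$ commuting with $L_i$. A conformal Lagrangian immersion is an immersion $X:\Omega\to\mathbb{R}^4$ with $|X_x|=|X_y|=e^f$, $\langle X_x,X_y\rangle=0$, $X^*\omega=0$. Its Lagrangian angle map is a smooth $\beta:\Omega\to\mathbb{R}$ (determined up to a constant in $2\pi\mathbb{Z}$) with $(dx^1+i\,dx^2)\wedge(dx^3+i\,dx^4)(e^{-f}X_x,e^{-f}X_y)=e^{i\beta}$. $X$ is Hamiltonian stationary if it is critical for area under compactly supported Hamiltonian variations; by a known characterization, which may be taken as the definition, this is equivalent to $\Delta\beta=0$ on $\Omega$. A weakly conformal solution with Lagrangian angle map $\beta$ ($\beta$ harmonic) is a smooth map $X:\Omega\to\mathbb{R}^4$ satisfying $dX=e^{\beta L_i/2}(u\,dz+\bar u\,d\bar z)$ for some $u=a\epsilon+bL_i\bar\epsilon$ solving $\frac{\partial u}{\partial\bar z}=\frac12\frac{\partial\beta}{\partial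 z}L_i\bar u$, where $u$ is allowed to vanish. *)

(* Defs.v *)
From HB Require Import structures.
From mathcomp Require Import all_boot all_order all_algebra.
From mathcomp Require Import complex.
From mathcomp Require Import all_classical all_reals all_analysis.

Set Implicit Arguments.
Unset Strict Implicit.
Unset Printing Implicit Defensive.

Import Order.TTheory GRing.Theory Num.Theory.
Import numFieldNormedType.Exports.
Local Open Scope classical_set_scope.
Local Open Scope ring_scope.
Local Open Scope complex_scope.

(* The plane C of the independent variable z = x + iy is represented by the
   real normed space R * R, so that real differentiation is available on it;
   values that are complex numbers live in R[i]. *)

Section Domains.
Variable R : realType.
Implicit Types (Om : set (R * R)) (g : R -> R * R) (H : R * R -> R * R).

Definition is_loop Om g : Prop :=
  [/\ {within `[0, 1], continuous g},
      forall s : R, s \in `[0, 1] -> Om (g s)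
    & g 0 = g 1].

(* H (s, t): s is the parameter of the loop, t that of the homotopy. *)
Definition null_homotopic Om g : Prop :=
  exists H,
    [/\ {within `[0, 1] `*` `[0, 1], continuous H},
        forall s t : R, s \in `[0, 1] -> t \in `[0, 1] -> Om (H (s, t)),
        forall s : R, s \in `[0, 1] -> H (s, 0) = g s /\ H (s, 1) = g 0
      & forall t : R, t \in `[0, 1] -> H (0, t) = g 0 /\ H (1, t) = g 0].

Definition simply_connected_domain Om : Prop :=
  [/\ open Om, Om !=set0, connected Om
    & forall g, is_loop Om g -> null_homotopic Om g].

End Domains.

Section Calculus.
Variable R : realType.
Implicit Types (Om : set (R * R)) (z h : R * R).

(* Spelled out, because the axioms of numClosedFieldType determine its 'i only
   up to sign. *)
Definition iC : R[i] := 0 +i* 1.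

Definition e_x : R * R := (1, 0).
Definition e_y : R * R := (0, 1).

(* Functions are total; only their germs along the open set Om matter. *)
Fixpoint Cn (W : normedModType R) (n : nat) Om (F : R * R -> W) : Prop :=
  if n is m.+1 then
    (forall z, Om z -> differentiable F z) /\ (forall v, Cn m Om ('D_v F))
  else forall z, Om z -> {for z, continuous F}.

Definition smooth (W : normedModType R) Om (F : R * R -> W) : Prop :=
  forall n, Cn n Om F.

Definition csmooth Om (c : R * R -> R[i]) : Prop :=
  smooth Om (fun z => complex.Re (c z)) /\ smooth Om (fun z => complex.Im (c z)).

Definition laplacian (b : R * R -> R) z : R :=
  'D_e_x ('D_e_x b) z + 'D_e_y ('D_e_y b) z.

Definition harmonic_on Om (b : R * R -> R) : Prop :=
  smooth Om b /\ forall z, Om z -> laplacian b z = 0.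

Definition cpartial (v : R * R) (c : R * R -> R[i]) z : R[i] :=
  'D_v (fun y => complex.Re (c y)) z +i* 'D_v (fun y => complex.Im (c y)) z.

Definition d_z (c : R * R -> R[i]) z : R[i] :=
  2%:R^-1 * (cpartial e_x c z - iC * cpartial e_y c z).

Definition d_zbar (c : R * R -> R[i]) z : R[i] :=
  2%:R^-1 * (cpartial e_x c z + iC * cpartial e_y c z).

Definition d_zbar_vec (u : R * R -> 'cV[R[i]]_4) z : 'cV[R[i]]_4 :=
  \col_j d_zbar (fun y => u y j 0) z.

(* 1-forms, evaluated on a tangent vector h. *)
Definition dz h : R[i] := h.1 +i* h.2.
Definition dzbar h : R[i] := h.1 -i* h.2.

End Calculus.

Section SymplecticSpace.
Variable R : realType.
Implicit Types (p q : 'cV[R]_4) (A : 'M[R]_4).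

Definition x1 p : R := p (inord 0) 0.
Definition x2 p : R := p (inord 1) 0.
Definition x3 p : R := p (inord 2) 0.
Definition x4 p : R := p (inord 3) 0.

Definition inner p q : R := (p^T *m q) 0 0.
(* The Euclidean norm; the library's `|p| on matrices is the sup norm. *)
Definition enorm p : R := Num.sqrt (inner p p).

Definition wedge_form (K : comNzRingType) (xi eta : 'cV[R]_4 -> K) p q : K :=
  xi p * eta q - xi q * eta p.

Definition omega p q : R := wedge_form x1 x2 p q + wedge_form x3 x4 p q.

(* (dx^1 + i dx^2) /\ (dx^3 + i dx^4) *)
Definition hol_volume p q : R[i] :=
  wedge_form (fun y => x1 y +i* x2 y) (fun y => x3 y +i* x4 y) p q.

Definition cvec4 (K : Type) (c1 c2 c3 c4 : K) : 'cV[K]_4 :=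
  \col_j nth c1 [:: c1; c2; c3; c4] j.

(* The matrix of (x1, x2, x3, x4) |-> (- x2, x1, - x4, x3), over any ring. *)
Definition Li (K : pzRingType) : 'M[K]_4 :=
  \matrix_(j, k) nth 0 (nth [::] [:: [:: 0; -1; 0;  0];
                                     [:: 1;  0; 0;  0];
                                     [:: 0;  0; 0; -1];
                                     [:: 0;  0; 1;  0]] j) k.

Definition expmx A : 'M[R]_4 :=
  lim ((fun n => \sum_(k < n) (k`!%:R)^-1 *: A ^+ k) @ \oo).

Definition mxC m n (A : 'M[R]_(m, n)) : 'M[R[i]]_(m, n) :=
  map_mx (fun r : R => r%:C) A.
Definition conj_vec m n (A : 'M[R[i]]_(m, n)) : 'M[R[i]]_(m, n) :=
  map_mx (@conjc R) A.

Definition eps : 'cV[R[i]]_4 := 2%:R^-1 *: cvec4 1 0 (- iC R) 0.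
Definition epsbar : 'cV[R[i]]_4 := 2%:R^-1 *: cvec4 1 0 (iC R) 0.

Definition expi (t : R) : R[i] := cos t +i* sin t.

(* G and T are the linear part and the translation of an element
   x |-> G x + T of the group of affine transformations. *)
Definition in_group (G : 'M[R]_4) (T : 'cV[R]_4) : Prop :=
  [/\ G^T *m G = 1%:M, \det G = 1 & G *m Li R = Li R *m G].

End SymplecticSpace.

Section Immersions.
Variable R : realType.
Implicit Types (Om : set (R * R)) (X : R * R -> 'cV[R]_4) (z : R * R).
Implicit Types (f beta : R * R -> R) (a b : R * R -> R[i]).
Implicit Types (u : R * R -> 'cV[R[i]]_4).

Notation X_x X z := ('D_(@e_x R) X z).
Notation X_y X z := ('D_(@e_y R) X z).

Definition immersive_at X z : Prop := injective ('d X z).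

Definition isotropic_at X z : Prop :=
  forall h k, omega ('d X z h) ('d X z k) = 0.

Definition conformal_Lagrangian_immersion Om X f : Prop :=
  smooth Om X /\
  forall z, Om z ->
    [/\ immersive_at X z,
        enorm (X_x X z) = expR (f z),
        enorm (X_y X z) = expR (f z),
        inner (X_x X z) (X_y X z) = 0
      & isotropic_at X z].

Definition Lagrangian_angle Om X f beta : Prop :=
  smooth Om beta /\
  forall z, Om z ->
    hol_volume (expR (- f z) *: X_x X z) (expR (- f z) *: X_y X z)
      = expi (beta z).

Definition Hamiltonian_stationary Om X f : Prop :=
  exists2 beta, Lagrangian_angle Om X f beta & harmonic_on Om beta.

(* As above, but X_x and X_y may vanish.  The angle condition is written
   without dividing by |X_x| |X_y| = e^(2f): it is the usual one where X is
   immersive and is empty at the branch points. *)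
Definition weakly_conformal_HSL Om X beta : Prop :=
  [/\ smooth Om X, harmonic_on Om beta
    & forall z, Om z ->
      [/\ enorm (X_x X z) = enorm (X_y X z),
          inner (X_x X z) (X_y X z) = 0,
          isotropic_at X z
        & hol_volume (X_x X z) (X_y X z)
            = (enorm (X_x X z) * enorm (X_y X z))%:C * expi (beta z)]].

Definition spinor a b : R * R -> 'cV[R[i]]_4 :=
  fun z => a z *: eps R + b z *: (Li R[i] *m epsbar R).

Definition dirac_equation Om beta u : Prop :=
  forall z, Om z ->
    d_zbar_vec u z
      = (2%:R^-1 * d_z (fun y => (beta y)%:C) z) *: (Li R[i] *m conj_vec (u z)).

(* dX = e^(beta Li / 2) (u dz + ubar d zbar), evaluated on every h. *)
Definition dX_equation Om X beta u : Prop :=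
  forall z, Om z -> forall h : R * R,
    mxC ('d X z h)
      = mxC (expmx ((beta z / 2%:R) *: Li R))
          *m (dz h *: u z + dzbar h *: conj_vec (u z)).

Definition weakly_conformal_solution Om X beta : Prop :=
  [/\ harmonic_on Om beta, smooth Om X
    & exists a b,
      [/\ csmooth Om a, csmooth Om b,
          dirac_equation Om beta (spinor a b)
        & dX_equation Om X beta (spinor a b)]].

End Immersions.

(* Main.v *)
Require Import Defs.
From HB Require Import structures.
From mathcomp Require Import all_boot all_order all_algebra.
From mathcomp Require Import complex.
From mathcomp Require Import all_classical all_reals all_analysis.
From mathcomp Require Import ring lra.
Import Order.TTheory GRing.Theory Num.Theory.
Import numFieldNormedType.Exports.
Local Open Scope classical_set_scope.
Local Open Scope ring_scope.

(** R^4 with the complex structure Li is C^2, rotLi t is multiplication by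
    exp (i t), and J is the map (w1, w2) |-> (- conj w2, conj w1), which
    anticommutes with Li. Vectors p and q of the same length form an orthogonal
    frame of a Lagrangian plane of angle t exactly when q = exp (i t) J p
    (frame_from_angle, angle_of_frame). As J (exp (i s) p) = exp (- i s) J p, half
    of the rotation can be moved from q to p. So a conformal Lagrangian map of
    angle beta is a map with X_x = exp (i beta / 2) P and
    X_y = exp (i beta / 2) J P for a vector function P, and P vanishes where X is
    not immersive. This is the relation frame_eq; the equation for dX is the same
    relation in complex notation, with u = (P - i J P) / 2 (dX_equation_frame).

    The Dirac equation for u says that the form exp (i beta / 2) (P dx + J P dy)
    is closed. For a given X this form is dX, and closedness is the symmetry of
    second derivatives (mixed_derivatives, frame_eq_dirac). Conversely, on a
    simply connected domain a closed form is exact (closed_form_exact), which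
    yields X from u (frame_integrable).

    Since the loops and homotopies of the domain are merely continuous, the
    integral of a closed form along a path is defined as a sum of increments of
    local primitives over a fine dyadic subdivision. A null homotopy, cut into
    cells lying in squares on which the form is exact, shows that the integral
    along a loop is zero (path_sum_homotopy), so that integration from a base point
    gives a primitive (global_primitive).

    For a fixed beta, frame_eq is linear in the pair (X, P), hence the solutions of
    angle beta form a vector space V. Rotating X by exp (i c / 2) adds c to the
    angle, so every solution whose angle differs from beta by a constant is a
    rotation of an element of V (solution_rotate). Conversely, a unitary map G of
    complex determinant exp (i c) satisfies G J = exp (i c) J G (unitary_J), so it
    sends solutions of angle beta to solutions of angle beta + c
    (solution_motion). *)

Set Implicit Arguments.
Unset Strict Implicit.
Unset Printing Implicit Defensive.

(** * Smooth maps on open subsets of the plane *)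

Section FirstOrderApproximation.
Context {R : realType}.

(** The epsilon form of differentiability, for functions that are not built
    from differentiable ones. *)
Lemma is_diff_approx {V W : normedModType R} (F : V -> W)
    (L : {linear V -> W}) (z : V) : continuous L ->
  (forall e : R, 0 < e ->
     \forall v \near 0, `|F (v + z) - F z - L v| <= e * `|v|) ->
  differentiable F z /\ 'd F z = L :> (V -> W).
Proof.
move=> cL app.
have E : F \o shift z = cst (F z) + L +o_ 0 id.
  apply/eqaddoP => e e0; near=> v.
  by rewrite /= opprD addrA; near: v; exact: app.
have dE := diff_unique cL E; split=> //; apply/diff_locallyP.
by rewrite dE; split.
Unshelve. all: by end_near. Qed.

Lemma near_eq_diff {V W : normedModType R} (F G : V -> W) z :
  {near z, F =1 G} -> differentiable F z -> differentiable G z.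
Proof.
move=> FG dF; apply: (proj1 (is_diff_approx (L := 'd F z) _ _)).
  exact: diff_continuous.
move=> e e0; have [_ E] := (diff_locallyP _ _).1 dF.
have /eqaddoP/(_ e e0) E' := E.
have FGv : \forall v \near 0, F (v + z) = G (v + z).
  by have := FG; rewrite (near_shift 0) subr0.
near=> v; rewrite -(near FGv) // -(nbhs_singleton FG).
have : `|(F \o shift z - (cst (F z) + 'd F z)) v| <= e * `|id v| by near: v.
by rewrite /= opprD addrA.
Unshelve. all: by end_near. Qed.

End FirstOrderApproximation.

Section SmoothMaps.
Context {R : realType}.
Implicit Types (Om U : set (R * R)) (z v : R * R) (f g : R * R -> R).

Lemma near_on_open Om z (P : R * R -> Prop) :
  open Om -> Om z -> (forall y, Om y -> P y) -> \forall y \near z, P y.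
Proof.
by move=> oOm Oz OP; near=> y; apply: OP; near: y; exact: open_nbhs_nbhs.
Unshelve. all: by end_near. Qed.

(** Functions are total, but on an open set their values on it determine all
    their derivatives there. *)
Lemma Cn_eq {W : normedModType R} Om n (F G : R * R -> W) :
  open Om -> (forall z, Om z -> F z = G z) -> Cn n Om F -> Cn n Om G.
Proof.
move=> oOm; elim: n F G => [|n IHn] F G FG /=.
  move=> cF z Oz; have cFz : F y @[y --> z] --> F z := cF z Oz.
  rewrite FG // in cFz; apply: cvg_trans cFz; apply: near_eq_cvg.
  by apply: near_on_open Oz _ => // y Oy; rewrite FG.
move=> [dF CF]; split=> [z Oz|v].
  by apply: near_eq_diff (dF z Oz); apply: near_on_open Oz _.
apply: IHn (CF v) => z Oz; apply: near_eq_derive.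
by apply: near_on_open Oz _.
Qed.

Lemma derive_eq_on {W : normedModType R} Om (F G : R * R -> W) z v :
  open Om -> (forall z, Om z -> F z = G z) -> Om z -> 'D_v F z = 'D_v G z.
Proof. by move=> oOm FG Oz; apply: near_eq_derive; by apply: near_on_open Oz _. Qed.

Lemma Cn_pred {W : normedModType R} Om n (F : R * R -> W) :
  Cn n.+1 Om F -> Cn n Om F.
Proof.
elim: n F => [|n IHn] F [dF CF].
  by move=> z Oz; exact/differentiable_continuous/dF.
by split=> // v; apply: IHn; exact: CF.
Qed.

Lemma Cn_subset {W : normedModType R} Om U n (F : R * R -> W) :
  U `<=` Om -> Cn n Om F -> Cn n U F.
Proof.
move=> UOm; elim: n F => [|n IHn] F /= CF; first by move=> z /UOm /CF.
by case: CF => dF CF; split=> [z /UOm|v]; [exact: dF|exact: IHn (CF v)].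
Qed.

Lemma smooth_eq {W : normedModType R} Om (F G : R * R -> W) :
  open Om -> (forall z, Om z -> F z = G z) -> smooth Om F -> smooth Om G.
Proof. by move=> oOm FG sF n; apply: Cn_eq FG (sF n). Qed.

Lemma smooth_subset {W : normedModType R} Om U (F : R * R -> W) :
  U `<=` Om -> smooth Om F -> smooth U F.
Proof. by move=> UOm sF n; apply: Cn_subset UOm (sF n). Qed.

Lemma smooth_diff {W : normedModType R} Om (F : R * R -> W) z :
  smooth Om F -> Om z -> differentiable F z.
Proof. by move=> sF Oz; case: (sF 1) => dF _; exact: dF. Qed.

Lemma smooth_derive {W : normedModType R} Om (F : R * R -> W) v :
  smooth Om F -> smooth Om ('D_v F).
Proof. by move=> sF n; have [_] := sF n.+1; exact. Qed.

Lemma smooth_of_derive {W : normedModType R} Om (F : R * R -> W) :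
  (forall z, Om z -> differentiable F z) ->
  (forall v, smooth Om ('D_v F)) -> smooth Om F.
Proof.
move=> dF sF [|n]; last by split=> // v; exact: sF.
by move=> z Oz; exact/differentiable_continuous/dF.
Qed.

Lemma Cn_cst {W : normedModType R} Om n (w : W) : Cn n Om (fun=> w).
Proof.
elim: n w => [|n IHn] w /=; first by move=> z _; exact: cvg_cst.
split=> [z _|v]; first by rewrite -[fun=> w]/(cst w); apply: differentiable_cst.
suff -> : 'D_v (fun=> w) = (fun=> 0) by [].
by apply/funext => z; exact: derive_cst.
Qed.

Lemma CnD {W : normedModType R} Om n (F G : R * R -> W) : open Om ->
  Cn n Om F -> Cn n Om G -> Cn n Om (fun z => F z + G z).
Proof.
move=> oOm; elim: n F G => [|n IHn] F G /=.
  by move=> cF cG z Oz; apply: cvgD; [exact: cF|exact: cG].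
move=> [dF CF] [dG CG]; split=> [z Oz|v].
  by apply: differentiableD; [exact: dF|exact: dG].
apply: Cn_eq (IHn _ _ (CF v) (CG v)) => // z Oz.
by rewrite -deriveD //; apply: diff_derivable; [exact: dF|exact: dG].
Qed.

Lemma CnM Om n f g : open Om ->
  Cn n Om f -> Cn n Om g -> Cn n Om (fun z => f z * g z).
Proof.
move=> oOm; elim: n f g => [|n IHn] f g.
  by move=> /= cf cg z Oz; exact: (continuousM (cf z Oz) (cg z Oz)).
move=> Cf Cg; have [[df Cdf] [dg Cdg]] := (Cf, Cg); split=> [z Oz|v].
  by apply: differentiableM; [exact: df|exact: dg].
have [Cf' Cg'] := (Cn_pred Cf, Cn_pred Cg).
have H : Cn n Om (fun z => f z * 'D_v g z + g z * 'D_v f z).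
  by apply: CnD => //; [exact: IHn Cf' (Cdg v)|exact: IHn Cg' (Cdf v)].
apply: Cn_eq H => // z Oz.
by rewrite -deriveM //; apply: diff_derivable; [exact: df|exact: dg].
Qed.

Lemma derive_comp1 (phi : R -> R) (dphi : R) f z v :
  is_derive (f z) (1 : R) phi dphi -> differentiable f z ->
  differentiable (phi \o f) z /\ 'D_v (phi \o f) z = dphi * 'D_v f z.
Proof.
move=> dp df.
have dp' : differentiable phi (f z) by apply/derivable1_diffP.
have dc : differentiable (phi \o f) z by exact: differentiable_comp.
split=> //; rewrite !deriveE // diff_comp //=.
rewrite -[X in 'd phi _ X]mulr1 [LHS]linearZ mulrC; congr (_ * _).
by rewrite -deriveE // derive_val.
Qed.

(** Proved together, since the derivative of each involves the other. *)
Lemma Cn_cos_sin Om n f : open Om -> Cn n Om f ->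
  Cn n Om (fun z => cos (f z)) /\ Cn n Om (fun z => sin (f z)).
Proof.
move=> oOm; elim: n f => [|n IHn] f.
  move=> /= cf; split=> z Oz; apply: (continuous_comp (cf z Oz)).
    exact: continuous_cos.
  exact: continuous_sin.
move=> Cf; have [df Cdf] := Cf; have [Cc Cs] := IHn _ (Cn_pred Cf).
split; split=> [z Oz|v].
- by have [] := derive_comp1 0 (is_derive_cos (f z)) (df z Oz).
- have H : Cn n Om (fun z => -1 * (sin (f z) * 'D_v f z)).
    have C1 : Cn n Om (fun=> -1 : R) by exact: Cn_cst.
    have C2 := CnM oOm Cs (Cdf v).
    exact: (CnM oOm C1 C2).
  apply: Cn_eq H => // z Oz.
  have [_ /= ->] := derive_comp1 v (is_derive_cos (f z)) (df z Oz).
  by rewrite mulrA mulN1r.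
- by have [] := derive_comp1 0 (is_derive_sin (f z)) (df z Oz).
- have H : Cn n Om (fun z => cos (f z) * 'D_v f z).
    exact: (CnM oOm Cc (Cdf v)).
  apply: Cn_eq H => // z Oz.
  by have [_ /= ->] := derive_comp1 v (is_derive_sin (f z)) (df z Oz).
Qed.

Lemma smooth_cst {W : normedModType R} Om (w : W) : smooth Om (fun=> w).
Proof. by move=> n; exact: Cn_cst. Qed.

Lemma smoothD {W : normedModType R} Om (F G : R * R -> W) : open Om ->
  smooth Om F -> smooth Om G -> smooth Om (fun z => F z + G z).
Proof. by move=> oOm sF sG n; exact: CnD. Qed.

Lemma smoothM Om f g : open Om ->
  smooth Om f -> smooth Om g -> smooth Om (fun z => f z * g z).
Proof. by move=> oOm sf sg n; exact: CnM. Qed.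

Lemma smoothN Om f : open Om -> smooth Om f -> smooth Om (fun z => - f z).
Proof.
move=> oOm sf; have s1 : smooth Om (fun=> -1 : R) by exact: smooth_cst.
by apply: smooth_eq (smoothM oOm s1 sf) => // z _; rewrite mulN1r.
Qed.

Lemma smooth_cos Om f : open Om -> smooth Om f -> smooth Om (fun z => cos (f z)).
Proof. by move=> oOm sf n; have [] := Cn_cos_sin oOm (sf n). Qed.

Lemma smooth_sin Om f : open Om -> smooth Om f -> smooth Om (fun z => sin (f z)).
Proof. by move=> oOm sf n; have [] := Cn_cos_sin oOm (sf n). Qed.

Lemma derive_coord m n (F : R * R -> 'M[R]_(m, n)) i j z v :
  differentiable F z -> 'D_v (fun y => F y i j) z = 'D_v F z i j.
Proof. by move=> dF; rewrite derive_mx ?mxE //; exact: diff_derivable. Qed.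

Lemma differentiable_mxcoord m n (F : R * R -> 'M[R]_(m, n)) i j z :
  differentiable F z -> differentiable (fun y => F y i j) z.
Proof.
by move=> dF; exact: (differentiable_comp dF (differentiable_coord _ _ _)).
Qed.

Lemma smooth_coord m n Om (F : R * R -> 'M[R]_(m, n)) i j : open Om ->
  smooth Om F -> smooth Om (fun z => F z i j).
Proof.
move=> oOm sF k; elim: k F sF => [|k IHk] F sF.
  move=> z Oz; apply/differentiable_continuous/differentiable_mxcoord.
  exact: smooth_diff sF Oz.
split=> [z Oz|v]; first by apply/differentiable_mxcoord/(smooth_diff sF Oz).
apply: Cn_eq (IHk _ (smooth_derive v sF)) => // z Oz.
by rewrite derive_coord //; exact: smooth_diff sF Oz.
Qed.

Lemma differentiable_cV n (F : R * R -> 'cV[R]_n) z :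
  (forall i, differentiable (fun y => F y i 0) z) -> differentiable F z.
Proof.
move=> dF.
have -> : F = \sum_(i < n) (fun y => F y i 0 *: (delta_mx i 0 : 'cV[R]_n)).
  apply/funext => y; rewrite fct_sumE; apply/colP => j.
  rewrite summxE (bigD1 j) //= big1 => [|i ij]; rewrite !mxE ?eqxx ?mulr1 ?addr0 //.
  by rewrite eq_sym (negbTE ij) mulr0.
by apply: differentiable_sum => i; exact: differentiableZl.
Qed.

Lemma smooth_cV n Om (F : R * R -> 'cV[R]_n) : open Om ->
  (forall i, smooth Om (fun z => F z i 0)) -> smooth Om F.
Proof.
move=> oOm sF k; elim: k F sF => [|k IHk] F sF.
  move=> z Oz; apply/differentiable_continuous/differentiable_cV => i.
  exact: smooth_diff (sF i) Oz.
have dF z : Om z -> differentiable F z.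
  by move=> Oz; apply/differentiable_cV => i; exact: smooth_diff (sF i) Oz.
split=> // v; apply: IHk => i.
apply: smooth_eq (smooth_derive v (sF i)) => // z Oz.
by rewrite derive_coord //; exact: dF.
Qed.

End SmoothMaps.

(** * Estimates along segments *)

Section OneVariable.
Context {R : realType}.

Lemma continuous_dist {V W : normedModType R} (f : V -> W) z (e : R) :
  {for z, continuous f} -> 0 < e ->
  exists2 d : R, 0 < d & forall w, `|w - z| < d -> `|f w - f z| <= e.
Proof.
move=> /cvgrPdist_le cf /cf /nbhs_normP[d /= d0 H]; exists d => // w wd.
by rewrite distrC; apply: H; rewrite /= distrC.
Qed.

(** Stated on a ball around one endpoint, which covers both orders of the
    endpoints. *)
Lemma mean_value_bound (g dg : R -> R) (x y C : R) :
  (forall t, `|t - x| <= `|y - x| -> is_derive t (1 : R) g (dg t)) ->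
  (forall t, `|t - x| <= `|y - x| -> `|dg t| <= C) ->
  `|g y - g x| <= C * `|y - x|.
Proof.
move=> dgP dgC.
wlog: / exists u v, [/\ u <= v, `|g y - g x| = `|g v - g u|,
    `|y - x| = `|v - u| &
    forall t, t \in `[u, v] -> `|t - x| <= `|y - x|].
  apply; case: (leP x y) => xy.
    exists x, y; split=> // t; rewrite in_itv /= => /andP[xt ty].
    by rewrite !ger0_norm ?subr_ge0 // lerB.
  exists y, x; split=> //; [exact: ltW|exact: distrC|exact: distrC|].
  move=> t; rewrite in_itv /= => /andP[yt tx].
  by rewrite !ler0_norm ?subr_le0 ?(ltW xy) // lerN2 lerB.
move=> [u [v [uv -> yxE sub]]].
have dg' t : t \in `[u, v] -> is_derive t (1 : R) g (dg t).
  by move=> /sub; exact: dgP.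
have gc : {within `[u, v], continuous g}.
  apply: derivable_within_continuous => t tuv.
  by have [] := dg' t tuv.
have dgo t : t \in `]u, v[ -> is_derive t (1 : R) g (dg t).
  by move=> tuv; apply: dg'; exact: subset_itv_oo_cc tuv.
have [c cuv ->] := MVT_segment uv dgo gc.
by rewrite normrM -yxE ler_wpM2r // dgC // sub.
Qed.

(** The antiderivative is the integral over [a, x], which is degenerate to
    the left of a. *)
Lemma continuous_antiderivative (h : R -> R) (a : R) : continuous h ->
  exists A : R -> R, forall x, a < x -> is_derive x (1 : R) A (h x).
Proof.
move=> ch; pose A x := (\int[@lebesgue_measure R]_(t in `[a, x]) h t)%R.
exists A => x ax.
have := @continuous_FTC1_closed R h a x (x + 1).
case=> //; first by rewrite ltrDl.
- apply: continuous_compact_integrable; first exact: segment_compact.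
  exact: continuous_subspaceT.
- exact: ch.
by move=> dA; rewrite derive1E => <-; exact: derivableP.
Qed.

Lemma is_derive_fsub (f g : R -> R) (t df dg : R) :
  is_derive t (1 : R) f df -> is_derive t (1 : R) g dg ->
  is_derive t (1 : R) (fun s => f s - g s) (df - dg).
Proof. by move=> ? ?; exact: is_deriveB. Qed.

Lemma is_derive_fscale (f : R -> R) (c t df : R) :
  is_derive t (1 : R) f df -> is_derive t (1 : R) (fun s => f s * c) (df * c).
Proof.
move=> dF; rewrite (_ : (fun s => f s * c) = (fun s => c *: f s)); last first.
  by apply/funext => s; exact: mulrC.
by rewrite mulrC; exact: is_deriveZ.
Qed.

Lemma is_derive_linear (c t : R) : is_derive t (1 : R) (fun s => c * s) c.
Proof.
rewrite -[X in is_derive _ _ _ X]mulr1.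
exact: (is_deriveZ c (is_derive_id t (1 : R))).
Qed.

Lemma is_derive_dist (B : R -> R) (y l e : R) :
  is_derive y (1 : R) B l -> 0 < e -> exists2 d : R, 0 < d &
    forall k, `|k| < d -> `|B (k + y) - B y - l * k| <= e * `|k|.
Proof.
move=> dB e0; have /derivable_nbhs : derivable B y (1 : R) by exact: ex_derive.
rewrite derive_val => /eqaddoP/(_ e e0)/nbhs_normP[d /= d0 H].
exists d => // k kd.
have /H : ball_ Num.norm 0 d k by rewrite /= sub0r normrN.
rewrite /= -[(_ - _) k]/(B (k *: (1 : R) + y) - (B y + k *: l)).
by rewrite {1}/GRing.scale /= mulr1 opprD addrA [l * k]mulrC.
Qed.

Lemma is_derive_line {V W : normedModType R} (F : V -> W) (c v : V) (t : R) :
  differentiable F (c + t *: v) ->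
  is_derive t (1 : R) (fun s => F (c + s *: v)) ('D_v F (c + t *: v)).
Proof.
move=> dF.
have dl : is_diff t (fun s : R => c + s *: v) ( *:%R^~ v).
  have := @is_diffD R R V (cst c) ( *:%R^~ v) 0 ( *:%R^~ v) t _ _.
  rewrite add0r; exact.
have dl' : differentiable (fun s : R => c + s *: v) t by exact: ex_diff.
have dFl : differentiable (F \o (fun s : R => c + s *: v)) t.
  exact: differentiable_comp.
apply: DeriveDef; first exact: diff_derivable.
rewrite (deriveE _ dFl) diff_comp //= diff_val scale1r deriveE //.
Qed.

Lemma is_derive_horizontal {W : normedModType R} (F : R * R -> W) (x y : R) :
  differentiable F (x, y) ->
  is_derive x (1 : R) (fun t => F (t, y)) ('D_(@e_x R) F (x, y)).
Proof.
have E t : (t, y) = (0, y) + t *: e_x R :> R * R.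
  by congr pair; rewrite /= /GRing.scale /= ?mulr1 ?mulr0 ?add0r ?addr0.
under [X in is_derive _ _ X _]eq_fun do rewrite E.
by rewrite E; exact: is_derive_line.
Qed.

Lemma is_derive_vertical {W : normedModType R} (F : R * R -> W) (x y : R) :
  differentiable F (x, y) ->
  is_derive y (1 : R) (fun t => F (x, t)) ('D_(@e_y R) F (x, y)).
Proof.
have E t : (x, t) = (x, 0) + t *: e_y R :> R * R.
  by congr pair; rewrite /= /GRing.scale /= ?mulr1 ?mulr0 ?add0r ?addr0.
under [X in is_derive _ _ X _]eq_fun do rewrite E.
by rewrite E; exact: is_derive_line.
Qed.

End OneVariable.

(** * Primitives on small squares *)

Section LocalPrimitive.
Context {R : realType}.
Implicit Types (P Q F : R * R -> R) (z v : R * R).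

(** The covector p dx + q dy. *)
Definition form_at (p q : R) (h : R * R) : R := p * h.1 + q * h.2.

Lemma form_at_is_linear p q : linear (form_at p q).
Proof. by move=> k h h'; rewrite /form_at /= /GRing.scale /=; ring. Qed.

HB.instance Definition _ p q :=
  GRing.isLinear.Build R (R * R)%type R _ (form_at p q) (form_at_is_linear p q).

Lemma form_at_continuous p q : continuous (form_at p q).
Proof.
move=> h.
have c1 : {for h, continuous (fun h : R * R => p * h.1)}.
  by apply: continuousM; [exact: cvg_cst|exact: cvg_fst].
have c2 : {for h, continuous (fun h : R * R => q * h.2)}.
  by apply: continuousM; [exact: cvg_cst|exact: cvg_snd].
exact: (continuousD c1 c2).
Qed.

Definition primitive_on P Q (A : set (R * R)) F :=
  forall z, A z ->
    differentiable F z /\ forall v, 'D_v F z = form_at (P z) (Q z) v.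

(** The retraction onto [c - r, c + r]. Precomposing with it turns continuity
    on a segment into continuity on the whole line. *)
Definition clamp (c r t : R) : R := Num.max (c - r) (Num.min t (c + r)).

Lemma clamp_continuous c r : continuous (clamp c r).
Proof.
move=> t.
have c1 : {for t, continuous (fun t => Num.min t (c + r))}.
  exact: (@continuous_min _ _ id (fun=> c + r) t (@cvg_id _ _) (@cvg_cst _ _ _ _ _)).
exact: (@continuous_max _ _ (fun=> c - r) _ t (@cvg_cst _ _ _ _ _) c1).
Qed.

Lemma clamp_dist c r t : 0 <= r -> `|clamp c r t - c| <= r.
Proof.
move=> r0.
have lo : c - r <= clamp c r t by rewrite /clamp le_max lexx.
have hi : clamp c r t <= c + r.
  by rewrite /clamp ge_max ge_min lexx orbT andbT; lra.
by rewrite ler_norml; apply/andP; split; lra.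
Qed.

Lemma clamp_id c r t : `|t - c| <= r -> clamp c r t = t.
Proof.
rewrite ler_norml /clamp => /andP[? ?].
by rewrite min_l ?max_r //; lra.
Qed.

Lemma normr_prod_le (v : R * R) : `|v.1| <= `|v| /\ `|v.2| <= `|v|.
Proof. by rewrite prod_normE !le_max !lexx orbT. Qed.

Lemma ball_prodE (z w : R * R) (r : R) :
  ball z r w <-> `|w.1 - z.1| < r /\ `|w.2 - z.2| < r.
Proof.
rewrite -ball_normE /= distrC prod_normE gt_max; split.
  by move/andP.
by move=> [? ?]; apply/andP.
Qed.

(** The segment is compact, so the modulus of continuity at its points can be
    chosen the same for all of them. *)
Lemma uniform_on_segment (G : R * R -> R) (a r y e : R) :
  0 < e -> (forall s, `|s - a| <= r -> {for (s, y), continuous G}) ->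
  exists2 d : R, 0 < d & forall s t, `|s - a| <= r -> `|t - y| < d ->
    `|G (s, t) - G (s, y)| <= e.
Proof.
move=> e0 cG.
have cK : compact `[a - r, a + r] by exact: segment_compact.
have /compact_near_coveringP/(_ R (nbhs (y : R))
  (fun t s => `|G (s, t) - G (s, y)| <= e) _) := cK.
case.
  move=> s; rewrite /= in_itv /= => /andP[as1 sa].
  have sr : `|s - a| <= r by rewrite ler_norml; apply/andP; split; lra.
  have e2 : 0 < e / 2 by rewrite divr_gt0.
  have [d d0 H] := continuous_dist (cG s sr) e2.
  exists (ball s d, ball (y : R) d) => /=.
    by split; apply: nbhsx_ballx.
  move=> [s' t] /= [/= sd td].
  have -> : G (s', t) - G (s', y) = (G (s', t) - G (s, y)) - (G (s', y) - G (s, y)).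
    by rewrite opprB addrA subrK.
  rewrite (le_trans (ler_normB _ _)) // [leRHS]splitr lerD // H //.
    rewrite prod_normE /= gt_max.
    by move: sd td; rewrite -!ball_normE /= ![`|_ - s'|]distrC ![`|y - _|]distrC => -> ->.
  rewrite prod_normE /= gt_max subrr normr0 d0 andbT.
  by move: sd; rewrite -ball_normE /= distrC.
move=> d /= d0 H; exists d => // s t sr td.
have bt : ball (y : R) d t by rewrite -ball_normE /= distrC.
have Is : `[a - r, a + r]%classic s.
  rewrite /= in_itv /=; move: sr; rewrite ler_norml => /andP[? ?].
  by apply/andP; split; lra.
exact: H bt _ Is.
Qed.

(** Poincare's lemma on a square (balls of the product norm are squares):
    integrate Q up the vertical line through the centre, then P along
    horizontal lines. That the second integral has the right y-derivative
    follows from the mean value inequality, first in x, where closedness turns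
    the x-derivative of Q into the y-derivative of P, then in y. *)
Lemma local_primitive Om P Q (p : R * R) : open Om -> Om p ->
  (forall z, Om z -> differentiable P z) ->
  (forall z, Om z -> differentiable Q z) ->
  (forall z, Om z -> 'D_(@e_y R) P z = 'D_(@e_x R) Q z) ->
  (forall z, Om z -> {for z, continuous ('D_(@e_y R) P)}) ->
  exists r : R, 0 < r /\ exists F, primitive_on P Q (ball p r) F.
Proof.
case: p => a b oOm Op dP dQ PQ cPy.
have [r r0 sub] : exists2 r : R, 0 < r &
    forall x y, `|x - a| <= r -> `|y - b| <= r -> Om (x, y).
  have /nbhs_ballP[r' /= r'0 H] := open_nbhs_nbhs (conj oOm Op).
  exists (r' / 2) => [|x y xa yb]; first by rewrite divr_gt0.
  by apply: H; apply/ball_prodE => /=; split; lra.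
have ca t : `|clamp a r t - a| <= r by apply: clamp_dist; exact: ltW.
have cb t : `|clamp b r t - b| <= r by apply: clamp_dist; exact: ltW.
have cPh y : continuous (fun t => P (clamp a r t, clamp b r y)).
  move=> t; have cl := clamp_continuous (c := a) (r := r) (x := t).
  apply: (@continuous_comp _ _ _ (fun t => (clamp a r t, clamp b r y)) P).
    exact: (cvg_pair cl (cvg_cst _)).
  exact: (differentiable_continuous (dP _ (sub _ _ (ca t) (cb y)))).
have cQv : continuous (fun t => Q (a, clamp b r t)).
  move=> t; have cl := clamp_continuous (c := b) (r := r) (x := t).
  apply: (@continuous_comp _ _ _ (fun t => (a, clamp b r t)) Q).
    exact: (cvg_pair (cvg_cst _) cl).
  have aa : `|a - a| <= r by rewrite subrr normr0 ltW.
  exact: (differentiable_continuous (dQ _ (sub _ _ aa (cb t)))).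
have /choice[A dA] y : exists A : R -> R, forall x, a - r < x ->
    is_derive x (1 : R) A (P (clamp a r x, clamp b r y)).
  exact: continuous_antiderivative.
have [B dB] := @continuous_antiderivative R _ (b - r) cQv.
pose F z := B z.2 + A z.2 z.1 - A z.2 a.
exists r; split=> //; exists F => -[x y] /ball_prodE[/= xa yb].
suff [dF dFE] : differentiable F (x, y) /\
    'd F (x, y) = form_at (P (x, y)) (Q (x, y)) :> (R * R -> R).
  by split=> // v; rewrite deriveE // dFE.
apply: is_diff_approx; first exact: form_at_continuous.
(* The error is at most e |h| in x and e |k| + e |k| r in y. *)
move=> e' e'0; pose e := e' / (2 + r).
have r2 : 0 < 2 + r by lra.
have e0 : 0 < e by rewrite divr_gt0.
have Oz : Om (x, y) by apply: sub; exact: ltW.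
have [d1 d10 H1] := continuous_dist (differentiable_continuous (dP _ Oz)) e0.
have [d2 d20 H2] : exists2 d : R, 0 < d & forall s t,
    `|s - a| <= `|x - a| -> `|t - y| < d ->
    `|'D_(@e_y R) P (s, t) - 'D_(@e_y R) P (s, y)| <= e.
  apply: (@uniform_on_segment ('D_(@e_y R) P) a `|x - a| y e e0) => s sx.
  apply: cPy.
  by apply: sub; [exact: le_trans sx (ltW xa)|exact: ltW].
have [d3 d30 H3] : exists2 d : R, 0 < d & forall k, `|k| < d ->
    `|B (y + k) - B y - Q (a, y) * k| <= e * `|k|.
  have yr : b - r < y by move: yb; rewrite ltr_norml => /andP[? _]; lra.
  have [d d0 H] := is_derive_dist (dB y yr) e0; exists d => // k /H.
  by rewrite (clamp_id (ltW yb)) [y + k]addrC.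
have [d4 d40 H4] : exists2 d : R, 0 < d & forall v : R * R, `|v| < d ->
    `|v.1 + x - a| < r /\ `|v.2 + y - b| < r.
  exists (Num.min (r - `|x - a|) (r - `|y - b|)).
    by rewrite lt_min !subr_gt0 xa yb.
  move=> v; rewrite lt_min => /andP[v1 v2]; have [n1 n2] := normr_prod_le v.
  by rewrite -!addrA; split; apply: le_lt_trans (ler_normD _ _) _; lra.
apply/nbhs_normP; exists (Num.min (Num.min d1 d2) (Num.min d3 d4)).
  by rewrite /= !lt_min d10 d20 d30 d40.
move=> v /=; rewrite sub0r normrN => vd.
have [v1 v2] := normr_prod_le v.
move: vd; rewrite !lt_min => /andP[/andP[vd1 vd2] /andP[vd3 vd4]].
have [ra rb] := H4 v vd4.
case: v v1 v2 vd1 vd2 vd3 vd4 ra rb => h k /= v1 v2 vd1 vd2 vd3 vd4 ra rb.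
set N := `|(h, k)| in v1 v2 vd1 vd2 vd3 vd4 *.
have dA' s t : `|s - a| < r -> `|t - b| < r ->
    is_derive s (1 : R) (A t) (P (s, t)).
  move=> sr tr; have := dA t s; rewrite (clamp_id (ltW sr)) (clamp_id (ltW tr)); apply.
  by move: sr; rewrite ltr_norml => /andP[? _]; lra.
have E1 : `|A (k + y) (h + x) - A (k + y) x - P (x, y) * h| <= e * `|h|.
  pose g t := A (k + y) t - P (x, y) * t.
  have := @mean_value_bound R g (fun t => P (t, k + y) - P (x, y)) x (h + x) e.
  rewrite addrK; have -> : g (h + x) - g x =
    A (k + y) (h + x) - A (k + y) x - P (x, y) * h by rewrite /g; ring.
  apply => t th.
    have tr : `|t - a| < r.
      have := H4 (t - x, k); rewrite /= subrK => /(_ _)[] //.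
      apply: le_lt_trans vd4; rewrite /N !prod_normE /=.
      by rewrite ge_max !le_max th lexx orbT.
    exact: is_derive_fsub (dA' t (k + y) tr rb) (is_derive_linear _ _).
  apply: H1; apply: le_lt_trans vd1; rewrite prod_normE /= addrK.
  by rewrite ge_max (le_trans th v1) v2.
have E2 : `|F (x, k + y) - F (x, y) - Q (x, y) * k| <= e * `|k| * (1 + r).
  (* g a is the error of B, and g' measures the failure of Q k to be the change
     of the integral of P; it is small because Q_x = P_y. *)
  pose g s := A (k + y) s - A y s - Q (s, y) * k.
  have -> : F (x, k + y) - F (x, y) - Q (x, y) * k =
      (B (k + y) - B y - Q (a, y) * k) + (g x - g a).
    by rewrite /F /g /=; ring.
  apply: le_trans (ler_normD _ _) _; rewrite mulrDr mulr1 lerD //.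
    by rewrite [k + y]addrC H3 // (le_lt_trans v2).
  have gb : `|g x - g a| <= e * `|k| * `|x - a|.
    apply: (@mean_value_bound R g
      (fun s => P (s, k + y) - P (s, y) - 'D_(@e_x R) Q (s, y) * k)).
      move=> t ta; have tr := le_lt_trans ta xa.
      have dAA := is_derive_fsub (dA' t _ tr rb) (dA' t _ tr yb).
      apply: is_derive_fsub dAA _; apply: is_derive_fscale.
      by apply: is_derive_horizontal; apply: dQ; apply: sub; exact: ltW.
    move=> t ta; have tr := le_lt_trans ta xa.
    have Ot : Om (t, y) by apply: sub; exact: ltW.
    rewrite -PQ //.
    pose phi w := P (t, w) - 'D_(@e_y R) P (t, y) * w.
    have := @mean_value_bound R phi
      (fun w => 'D_(@e_y R) P (t, w) - 'D_(@e_y R) P (t, y)) y (k + y) e.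
    rewrite addrK; have -> : phi (k + y) - phi y =
      P (t, k + y) - P (t, y) - 'D_(@e_y R) P (t, y) * k by rewrite /phi; ring.
    apply => w wk.
      apply: is_derive_fsub (is_derive_linear _ _).
      apply: is_derive_vertical; apply: dP; apply: sub; first exact: ltW.
      have := H4 (h, w - y); rewrite /= subrK => /(_ _)[] //; last by move=> _ /ltW.
      apply: le_lt_trans vd4; rewrite /N !prod_normE /=.
      by rewrite ge_max !le_max wk lexx orbT.
    by apply: H2 => //; apply: le_lt_trans wk (le_lt_trans v2 vd2).
  by apply: le_trans gb _; apply: ler_wpM2l; [rewrite mulr_ge0 // ltW|exact: ltW].
have -> : F ((h, k) + (x, y)) - F (x, y) - form_at (P (x, y)) (Q (x, y)) (h, k) =
    (A (k + y) (h + x) - A (k + y) x - P (x, y) * h) +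
    (F (x, k + y) - F (x, y) - Q (x, y) * k).
  by rewrite /F /form_at /=; ring.
apply: le_trans (ler_normD _ _) _.
have -> : e' = e * (1 + (1 + r)) by rewrite addrA divfK // gt_eqF.
rewrite mulrDr mulr1 mulrDl lerD //.
  by apply: le_trans E1 _; rewrite ler_wpM2l // ltW.
apply: le_trans E2 _; rewrite mulrAC; apply: ler_wpM2l => //.
by apply: mulr_ge0; [exact: ltW|rewrite addr_ge0 // ltW].
Qed.

End LocalPrimitive.

(** * Primitives on simply connected domains *)

Section GlobalPrimitive.
Context {R : realType}.
Variables (P Q : R * R -> R).
Implicit Types (Om : set (R * R)) (F : R * R -> R) (p q x y z : R * R).
Implicit Types (g : R -> R * R).

Lemma primitive_on_subset (A B : set (R * R)) F :
  A `<=` B -> primitive_on P Q B F -> primitive_on P Q A F.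
Proof. by move=> AB pF z /AB /pF. Qed.

Lemma ball_segment p x y (r t : R) : ball p r x -> ball p r y ->
  0 <= t <= 1 -> ball p r (x + t *: (y - x)).
Proof.
move=> /ball_prodE[+ +] /ball_prodE[+ +] /andP[t0 t1].
case: p x y => p1 p2 [x1 x2] [y1 y2] /= hx1 hx2 hy1 hy2.
suff conv (a b c : R) : `|a - c| < r -> `|b - c| < r ->
    `|a + t * (b - a) - c| < r.
  by apply/ball_prodE; split; apply: conv.
move=> ac bc.
have -> : a + t * (b - a) - c = (1 - t) * (a - c) + t * (b - c) by ring.
apply: le_lt_trans (ler_normD _ _) _.
rewrite !normrM (ger0_norm t0) (@ger0_norm _ (1 - t)) ?subr_ge0 //.
have -> : r = (1 - t) * r + t * r by ring.
have [t0'|t0'] := eqVneq t 0.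
  by rewrite t0' !mul0r !addr0 subr0 !mul1r.
have tp : 0 < t by rewrite lt_neqAle eq_sym t0'.
by apply: ler_ltD; [apply: ler_wpM2l; [rewrite subr_ge0|exact: ltW]|rewrite ltr_pM2l].
Qed.

(** Both squares contain the segment from x to y, and the difference of the
    two primitives has derivative zero along it. *)
Lemma primitive_increment_unique p p' (r r' : R) F F' x y :
  primitive_on P Q (ball p r) F -> primitive_on P Q (ball p' r') F' ->
  ball p r x -> ball p r y -> ball p' r' x -> ball p' r' y ->
  F y - F x = F' y - F' x.
Proof.
move=> pF pF' px py px' py'.
pose h (t : R) := F (x + t *: (y - x)) - F' (x + t *: (y - x)).
have dh (t : R) : t \in `[0, 1] -> is_derive t (1 : R) h 0.
  rewrite in_itv /= => t01.
  have [dF DF] := pF _ (ball_segment px py t01).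
  have [dF' DF'] := pF' _ (ball_segment px' py' t01).
  have := is_derive_fsub (is_derive_line dF) (is_derive_line dF').
  by rewrite DF DF' subrr.
have ch : {within `[0, 1], continuous h}.
  by apply: derivable_within_continuous => t /dh [].
have dho (t : R) : t \in `]0, 1[ -> is_derive t (1 : R) h 0.
  by move=> /subset_itv_oo_cc /dh.
have [c _] := MVT_segment ler01 dho ch.
rewrite mul0r /h scale1r scale0r addr0 [x + _]addrC subrK => E.
by apply/eqP; rewrite -subr_eq0 -E; apply/eqP; ring.
Qed.

(** The integral of the form from x to y inside any square on which it is
    exact; such a square exists only for nearby points. *)
Definition increment x y : R :=
  get [set d | exists p (r : R) F, [/\ primitive_on P Q (ball p r) F,
    ball p r x, ball p r y & d = F y - F x]].

Lemma incrementE p (r : R) F x y : primitive_on P Q (ball p r) F ->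
  ball p r x -> ball p r y -> increment x y = F y - F x.
Proof.
move=> pF px py; rewrite /increment; set S := [set _ | _].
have : S (get S) by apply: getPex; exists (F y - F x), p, r, F.
case=> p' [r' [F' [pF' px' py' ->]]].
exact: (primitive_increment_unique pF' pF).
Qed.

Definition dyadic (k i : nat) : R := i%:R / (2 ^ k)%:R.

(** Stands for the integral of the form along the merely continuous path g;
    its value is significant for large k only. *)
Definition path_sum g (k : nat) : R :=
  \sum_(i < 2 ^ k) increment (g (dyadic k i)) (g (dyadic k i.+1)).

Lemma dyadic_itv k i : (i <= 2 ^ k)%N -> 0 <= dyadic k i <= 1.
Proof.
by move=> ik; rewrite divr_ge0 //= ler_pdivrMr ?mul1r ?ler_nat // ltr0n expn_gt0.
Qed.

Lemma dyadicS k i : dyadic k i.+1 = dyadic k i + (2 ^ k)%:R^-1.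
Proof. by rewrite /dyadic -natr1 mulrDl mul1r. Qed.

Lemma dyadic0 k : dyadic k 0 = 0. Proof. by rewrite /dyadic mul0r. Qed.

Lemma dyadic1 k : dyadic k (2 ^ k) = 1.
Proof. by rewrite /dyadic divff // pnatr_eq0 -lt0n expn_gt0. Qed.

Lemma dyadic_small (d : R) : 0 < d ->
  exists N, forall k, (N <= k)%N -> (2 ^ k)%:R^-1 < d.
Proof.
move=> d0; exists (Num.bound d^-1) => k Nk.
rewrite -(invrK d) ltf_pV2 ?posrE ?invr_gt0 ?ltr0n ?expn_gt0 //.
have := archi_boundP (ltW (_ : 0 < d^-1)); rewrite invr_gt0 => /(_ d0) H.
apply: lt_trans H _; rewrite ltr_nat; apply: leq_ltn_trans Nk _.
exact: ltn_expl.
Qed.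

Definition locally_exact Om := forall p, Om p -> exists r : R,
  [/\ 0 < r, ball p r `<=` Om & exists F, primitive_on P Q (ball p r) F].

Definition unit_square : set (R * R) := `[0, 1] `*` `[0, 1].

(** Lebesgue's number lemma for the cover of the unit square by the preimages
    of squares on which the form is exact. *)
Lemma lebesgue_number Om (H : R * R -> R * R) : locally_exact Om ->
  continuous H -> (forall z, unit_square z -> Om (H z)) ->
  exists2 d : R, 0 < d & forall x, unit_square x ->
    exists p (r : R) F, primitive_on P Q (ball p r) F /\
      forall y, `|y - x| < d -> ball p r (H y).
Proof.
move=> exOm cH OmH.
have cK : compact unit_square by apply: compact_setX; exact: segment_compact.
have /compact_near_coveringP/(_ R (nbhs (0 : R)^'+) (fun d x =>
  exists p (r : R) F, primitive_on P Q (ball p r) F /\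
    forall y, `|y - x| < d -> ball p r (H y)) _) := cK.
case.
  move=> x Kx; have [r [r0 rO [F pF]]] := exOm _ (OmH _ Kx).
  have r2 : 0 < r / 2 by rewrite divr_gt0.
  have [d d0 Hd] := continuous_dist (cH x) r2.
  have d2 : 0 < d / 2 by rewrite divr_gt0.
  exists (ball x (d / 2), [set e | e < d / 2]) => /=.
    split; first exact: nbhsx_ballx.
    exact: nbhs_right_lt.
  move=> [x' e] /= [xx' ed]; exists (H x), r, F; split=> // y yx'.
  rewrite -ball_normE /= distrC; apply: le_lt_trans (Hd y _) _; last first.
    by rewrite ltr_pdivrMr // ltr_pMr // ltr1n.
  have -> : y - x = (y - x') + (x' - x) by rewrite addrA subrK.
  apply: le_lt_trans (ler_normD _ _) _; rewrite [ltRHS]splitr ltrD //.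
    exact: lt_trans yx' ed.
  by move: xx'; rewrite -ball_normE /= distrC.
move=> e /= e0 He; exists (e / 2); first by rewrite divr_gt0.
apply: He; rewrite /= ?sub0r ?normrN ?divr_gt0 //.
by rewrite gtr0_norm ?divr_gt0 // ltr_pdivrMr // ltr_pMr // ltr1n.
Unshelve. all: by end_near. Qed.

(** Summing around each cell of the dyadic grid gives zero once the mesh is
    below the Lebesgue number; adding up a row of cells cancels the vertical
    sides except the two outer ones. *)
Lemma path_sum_homotopy Om (H : R * R -> R * R) q : locally_exact Om ->
  continuous H -> (forall z, unit_square z -> Om (H z)) ->
  (forall t, 0 <= t <= 1 -> H (0, t) = q /\ H (1, t) = q) ->
  exists N, forall k, (N <= k)%N ->
    path_sum (fun s => H (s, 0)) k = path_sum (fun s => H (s, 1)) k.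
Proof.
move=> exOm cH OmH Hq; have [d d0 Hd] := lebesgue_number exOm cH OmH.
have [N HN] := dyadic_small d0; exists N => k Nk.
have chain (S : nat -> R) n : (forall j, (j < n)%N -> S j = S j.+1) -> S 0 = S n.
  elim: n => [//|n IHn] SS; rewrite (IHn (fun j jn => SS j (ltnW jn))).
  exact: SS.
rewrite -{1}(dyadic0 k) -(dyadic1 k).
apply: (chain (fun j => path_sum (fun s => H (s, dyadic k j)) k)) => j.
move=> jk; apply/eqP; rewrite -subr_eq0 /path_sum -sumrB.
pose V i := increment (H (dyadic k i, dyadic k j)) (H (dyadic k i, dyadic k j.+1)).
have VE i : (i < 2 ^ k)%N ->
    increment (H (dyadic k i, dyadic k j)) (H (dyadic k i.+1, dyadic k j)) -
    increment (H (dyadic k i, dyadic k j.+1)) (H (dyadic k i.+1, dyadic k j.+1))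
    = V i - V i.+1.
  move=> ik.
  have K : unit_square (dyadic k i, dyadic k j).
    by split; rewrite /= in_itv /= dyadic_itv // ltnW.
  have [p [r [F [pF ballF]]]] := Hd _ K.
  have k0 : 0 <= (2 ^ k)%:R^-1 :> R by rewrite invr_ge0.
  have near_corner (a b : bool) :
      ball p r (H (dyadic k (i + a), dyadic k (j + b))).
    apply: ballF; rewrite prod_normE gt_max /=.
    by apply/andP; split; [case: a|case: b]; rewrite ?addn1 ?addn0 ?dyadicS
       ?subrr ?normr0 // addrC addKr ger0_norm // HN.
  have := (near_corner false false, near_corner false true,
           near_corner true false, near_corner true true).
  rewrite !addn0 !addn1 => -[[[c00 c01] c10] c11].
  by rewrite /V !(incrementE pF) //; ring.
rewrite (eq_bigr (fun i : 'I__ => V i - V i.+1)) => [|i _]; last exact: VE.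
rewrite -(big_mkord xpredT (fun i => V i - V i.+1)).
rewrite (eq_bigr (fun i => - (V i.+1 - V i))) => [|i _]; last by rewrite opprB.
rewrite sumrN telescope_sumr // oppr_eq0 /V dyadic0 dyadic1.
have [h0 h1] := Hq _ (dyadic_itv (ltnW jk)).
have [h2 h3] := Hq _ (dyadic_itv jk).
by rewrite h0 h1 h2 h3 subrr.
Qed.

Lemma within_continuous_comp {T U V : topologicalType} (K : set U)
    (H : U -> V) (phi : T -> U) :
  {within K, continuous H} -> continuous phi -> (forall t, K (phi t)) ->
  continuous (H \o phi).
Proof.
move=> cH cphi Kphi t W HW.
have := cH (phi t) W HW; rewrite /nbhs /= -nbhs_subspace_in // => KW.
have := cphi t _ KW; rewrite !near_simpl => near_t.
by near=> s => /=; apply: (near near_t s) => //; exact: Kphi.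
Unshelve. all: by end_near. Qed.

(** Extends maps given on [0, 1] continuously to the line. *)
Definition unit_clamp : R -> R := clamp 2^-1 2^-1.

Lemma unit_clamp_itv t : 0 <= unit_clamp t <= 1.
Proof.
have := @clamp_dist R 2^-1 2^-1 t; rewrite -/(unit_clamp t) ler_norml.
have h2 : 2^-1 + 2^-1 = 1 :> R by rewrite [RHS]splitr mul1r.
have h0 : 0 <= 2^-1 :> R by rewrite invr_ge0.
by move=> /(_ h0)/andP[? ?]; apply/andP; split; lra.
Qed.

Lemma unit_clamp_id t : 0 <= t <= 1 -> unit_clamp t = t.
Proof.
have h2 : 2^-1 + 2^-1 = 1 :> R by rewrite [RHS]splitr mul1r.
move=> /andP[t0 t1]; apply: clamp_id; rewrite ler_norml.
by apply/andP; split; lra.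
Qed.

Lemma unit_clamp_le0 t : t <= 0 -> unit_clamp t = 0.
Proof.
have h2 : 2^-1 + 2^-1 = 1 :> R by rewrite [RHS]splitr mul1r.
by move=> t0; rewrite /unit_clamp /clamp subrr min_l ?max_l //; lra.
Qed.

Lemma unit_clamp_ge1 t : 1 <= t -> unit_clamp t = 1.
Proof.
have h2 : 2^-1 + 2^-1 = 1 :> R by rewrite [RHS]splitr mul1r.
move=> t1; rewrite /unit_clamp /clamp subrr h2 min_r // max_r //.
Qed.

Lemma unit_clamp_continuous : continuous unit_clamp.
Proof. exact: clamp_continuous. Qed.

Lemma eq_path_sum g g' k : (forall s, 0 <= s <= 1 -> g s = g' s) ->
  path_sum g k = path_sum g' k.
Proof.
by move=> gg; apply: eq_bigr => i _; rewrite !gg // dyadic_itv // ltnW.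
Qed.

Lemma incrementxx Om p : locally_exact Om -> Om p -> increment p p = 0.
Proof.
move=> exOm Op; have [r [r0 _ [F pF]]] := exOm _ Op.
by rewrite (incrementE pF) ?subrr //; exact: ballxx.
Qed.

(** A null homotopy carries the loop to a constant path, along which all
    increments vanish. *)
Lemma loop_path_sum Om g : (forall g, is_loop Om g -> null_homotopic Om g) ->
  locally_exact Om -> continuous g -> (forall s, 0 <= s <= 1 -> Om (g s)) ->
  g 0 = g 1 -> exists N, forall k, (N <= k)%N -> path_sum g k = 0.
Proof.
move=> scOm exOm cg Og g01.
have [] := scOm g.
  split=> [|s|//]; first exact: continuous_subspaceT.
  by rewrite in_itv /=; exact: Og.
move=> H [cH OH Hg Hq].
pose phi z := (unit_clamp z.1, unit_clamp z.2).
have phiK z : unit_square (phi z) by split; rewrite /= in_itv /= unit_clamp_itv.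
have cphi : continuous phi.
  move=> z; have c1 : {for z, continuous (fun z : R * R => unit_clamp z.1)}.
    by apply: continuous_comp; [exact: cvg_fst|exact: unit_clamp_continuous].
  have c2 : {for z, continuous (fun z : R * R => unit_clamp z.2)}.
    by apply: continuous_comp; [exact: cvg_snd|exact: unit_clamp_continuous].
  exact: (cvg_pair c1 c2).
have cHphi := within_continuous_comp cH cphi phiK.
have uc t : unit_clamp t \in `[0, 1] by rewrite in_itv /= unit_clamp_itv.
have uc0 : unit_clamp 0 = 0 by rewrite unit_clamp_le0.
have uc1 : unit_clamp 1 = 1 by rewrite unit_clamp_ge1.
have [||N HN] := @path_sum_homotopy Om (H \o phi) (g 0) exOm cHphi.
- by move=> z _; apply: OH.
- by move=> t _; rewrite /= /phi /= uc0 uc1; exact: Hq.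
exists N => k Nk; have := HN k Nk.
rewrite (@eq_path_sum _ g) => [|s s01]; last first.
  by rewrite /= /phi /= uc0 unit_clamp_id //; apply: (Hg s _).1; rewrite in_itv.
move=> ->; rewrite (@eq_path_sum _ (fun=> g 0)) => [|s s01]; last first.
  by rewrite /= /phi /= uc1; apply: (Hg _ (uc _)).2.
have Og0 : Om (g 0) by apply: Og; rewrite lexx ler01.
by rewrite /path_sum big1 // => i _; exact: incrementxx exOm Og0.
Qed.

Definition is_path Om p q g :=
  [/\ continuous g, forall s, 0 <= s <= 1 -> Om (g s), g 0 = p & g 1 = q].

(** Where one of the two clamped paths moves, the other one rests at the common
    endpoint q: a concatenation without case distinction. *)
Definition concat q g g' (s : R) : R * R :=
  g (unit_clamp (2 * s)) + g' (unit_clamp (2 * s - 1)) - q.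

Lemma concat_first q g g' s : g' 0 = q -> 0 <= s <= 1 ->
  concat q g g' (s / 2) = g s.
Proof.
move=> g'0 /andP[s0 s1]; rewrite /concat mulrC divfK ?pnatr_eq0 //.
rewrite unit_clamp_id ?s0 // [X in g' X]unit_clamp_le0 ?subr_le0 // g'0.
by rewrite addrK.
Qed.

Lemma concat_second q g g' s : g 1 = q -> 0 <= s <= 1 ->
  concat q g g' ((1 + s) / 2) = g' s.
Proof.
move=> g1 /andP[s0 s1]; rewrite /concat mulrC divfK ?pnatr_eq0 //.
rewrite unit_clamp_ge1 ?lerDl // g1 [X in unit_clamp X]addrC addKr unit_clamp_id ?s0 //.
by rewrite addrAC subrr add0r.
Qed.

Lemma concat_path Om p q r g g' : is_path Om p q g -> is_path Om q r g' ->
  is_path Om p r (concat q g g').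
Proof.
move=> [cg Og g0 g1] [cg' Og' g'0 g'1]; split.
- move=> s.
  have c1 : {for s, continuous (fun s : R => g (unit_clamp (2 * s)))}.
    apply: continuous_comp; last exact: cg.
    apply: (@continuous_comp _ _ _ (fun s : R => 2 * s) unit_clamp).
      exact: mulrl_continuous.
    exact: unit_clamp_continuous.
  have c2 : {for s, continuous (fun s : R => g' (unit_clamp (2 * s - 1)))}.
    apply: continuous_comp; last exact: cg'.
    apply: (@continuous_comp _ _ _ (fun s : R => 2 * s - 1) unit_clamp).
      by apply: continuousB; [exact: mulrl_continuous|exact: cvg_cst].
    exact: unit_clamp_continuous.
  exact: (continuousB (continuousD c1 c2) (cvg_cst _)).
- move=> s /andP[s0 s1].
  have -> : s = 2 * s / 2 by rewrite mulrC mulKf.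
  have [s2|s2] := leP (2 * s) 1.
    by rewrite concat_first //; [apply: Og|]; rewrite s2 mulr_ge0.
  have -> : 2 * s = 1 + (2 * s - 1) by ring.
  have s3 : 0 <= 2 * s - 1 <= 1 by apply/andP; split; lra.
  by rewrite concat_second //; exact: Og'.
- have := @concat_first q g g' 0 g'0; rewrite mul0r => -> //.
  by rewrite lexx ler01.
- have -> : 1 = (1 + 1) / 2 :> R by rewrite divff.
  by rewrite concat_second // lexx ler01.
Qed.

(** Dyadic subdivisions have 1/2 among their points, which is where the
    paths are joined. *)
Lemma path_sum_concat q g g' k : g 1 = q -> g' 0 = q ->
  path_sum (concat q g g') k.+1 = path_sum g k + path_sum g' k.
Proof.
move=> g1 g'0.
have half i : dyadic k.+1 i = dyadic k i / 2.
  by rewrite /dyadic expnS mulnC natrM invfM mulrA.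
have half' i : dyadic k.+1 (2 ^ k + i) = (1 + dyadic k i) / 2.
  by rewrite half /dyadic natrD mulrDl divff // pnatr_eq0 -lt0n expn_gt0.
rewrite /path_sum expnS mul2n -addnn big_split_ord /=; congr (_ + _).
  apply: eq_bigr => i _; rewrite !half !concat_first ?dyadic_itv //.
  exact: ltnW.
apply: eq_bigr => i _; rewrite -addnS !half' !concat_second ?dyadic_itv //.
exact: ltnW.
Qed.

Lemma reverse_path Om p q g : is_path Om p q g ->
  is_path Om q p (fun s => g (1 - s)).
Proof.
move=> [cg Og g0 g1]; split; rewrite ?subr0 ?subrr //.
- move=> s; apply: (@continuous_comp R R _ (fun s : R => 1 - s) g); last exact: cg.
  exact: (continuousB (cvg_cst _) cvg_id).
- by move=> s /andP[s0 s1]; apply: Og; apply/andP; split; lra.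
Qed.

(** Exchanging the ends changes the sign of an increment only if they lie in
    a common square, hence the restriction to fine subdivisions. *)
Lemma path_sum_reverse Om p q g : locally_exact Om -> is_path Om p q g ->
  exists N, forall k, (N <= k)%N ->
    path_sum (fun s => g (1 - s)) k = - path_sum g k.
Proof.
move=> exOm [cg Og g0 g1].
have cH : continuous (fun z : R * R => g z.1).
  by move=> z; apply: continuous_comp; [exact: cvg_fst|exact: cg].
have [|d d0 Hd] := lebesgue_number exOm cH.
  by move=> z [/= z1 _]; apply: Og; move: z1; rewrite in_itv.
have [N HN] := dyadic_small d0; exists N => k Nk.
rewrite /path_sum (reindex_inj rev_ord_inj) /= -sumrN; apply: eq_bigr => i _.
have rev j : (j <= 2 ^ k)%N -> 1 - dyadic k (2 ^ k - j) = dyadic k j.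
  move=> jk; rewrite /dyadic natrB // mulrBl divff ?pnatr_eq0 -?lt0n ?expn_gt0 //.
  by rewrite subKr.
rewrite -subSn ?ltn_ord // subSS !rev //; last exact: ltnW.
have K : unit_square (dyadic k i, 0).
  by split; rewrite /= in_itv /= ?lexx ?ler01 // dyadic_itv // ltnW.
have [p' [r [F [pF ballF]]]] := Hd _ K.
have b0 : ball p' r (g (dyadic k i)).
  by apply: (ballF (dyadic k i, 0)); rewrite subrr normr0.
have b1 : ball p' r (g (dyadic k i.+1)).
  apply: (ballF (dyadic k i.+1, 0)); rewrite prod_normE gt_max /= subrr normr0 d0.
  by rewrite dyadicS addrC addKr andbT ger0_norm ?invr_ge0 // HN.
by rewrite !(incrementE pF) // opprB.
Qed.

(** Inside one square the sums telescope, whatever the mesh. *)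
Lemma segment_path Om c (r : R) F x y : primitive_on P Q (ball c r) F ->
  ball c r `<=` Om -> ball c r x -> ball c r y ->
  exists g, is_path Om x y g /\ forall k, path_sum g k = F y - F x.
Proof.
move=> pF cO cx cy; exists (fun s => x + s *: (y - x)); split.
  split; rewrite ?scale0r ?scale1r ?addr0 //; last by rewrite addrC subrK.
    move=> s; apply: (@continuousD _ _ _ (fun=> x) (fun s : R => s *: (y - x))).
      exact: cvg_cst.
    exact: scalel_continuous.
  by move=> s s01; apply/cO/ball_segment.
move=> k; pose G i := F (x + dyadic k i *: (y - x)).
rewrite /path_sum (eq_bigr (fun i : 'I__ => G i.+1 - G i)) => [|i _]; last first.
  rewrite (incrementE pF) //; apply: ball_segment => //; apply: dyadic_itv => //.
  exact: ltnW.
rewrite -(big_mkord xpredT (fun i => G i.+1 - G i)) telescope_sumr //.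
by rewrite /G dyadic0 dyadic1 scale0r scale1r addr0 [x + _]addrC subrK.
Qed.

(** The sums do not just converge: refining a subdivision whose pieces lie in
    squares with a primitive does not change them. *)
Definition path_integral Om p q (v : R) := exists g, is_path Om p q g /\
  exists N, forall k, (N <= k)%N -> path_sum g k = v.

Lemma path_integral_extend Om p c (r : R) F x y v :
  primitive_on P Q (ball c r) F -> ball c r `<=` Om ->
  ball c r x -> ball c r y ->
  path_integral Om p x v -> path_integral Om p y (v + (F y - F x)).
Proof.
move=> pF cO cx cy [g [pg [N Ng]]]; have [g' [pg' Ng']] := segment_path pF cO cx cy.
exists (concat x g g'); split; first exact: concat_path pg pg'.
exists N.+1 => -[//|k] Nk; have [_ _ _ g1] := pg; have [_ _ g'0 _] := pg'.
by rewrite path_sum_concat // Ng // Ng'.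
Qed.

Lemma path_integral_unique Om p q v w :
  (forall g, is_loop Om g -> null_homotopic Om g) -> locally_exact Om ->
  path_integral Om p q v -> path_integral Om p q w -> v = w.
Proof.
move=> scOm exOm [g [pg [N Ng]]] [g' [pg' [N' Ng']]].
have pr := reverse_path pg'.
have [N1 HN1] := path_sum_reverse exOm pg'.
have [cl Ol l0 l1] := concat_path pg pr.
have [|N2 HN2] := loop_path_sum scOm exOm cl Ol; first by rewrite l0 l1.
pose k := maxn (maxn N N') (maxn N1 N2).
have [kN kN' kN1 kN2] : [/\ N <= k, N' <= k, N1 <= k & N2 <= k]%N.
  by rewrite /k !leq_max !leqnn !orbT.
have := HN2 k.+1 (leqW kN2); have [_ _ _ g1] := pg; have [_ _ r0 _] := pr.
rewrite path_sum_concat // Ng // HN1 // Ng' // => /eqP.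
by rewrite subr_eq0 => /eqP.
Qed.

(** The points joined to p by a path with an integral fill every square that
    they meet, so they form an open and closed subset of the connected Om. *)
Lemma path_integral_exists Om p q : open Om -> connected Om ->
  locally_exact Om -> Om p -> Om q -> exists v, path_integral Om p q v.
Proof.
move=> oOm cOm exOm Op Oq.
pose B := [set q | Om q /\ exists v, path_integral Om p q v].
suff BO : B = Om by have [] : B q by rewrite BO.
have ext c (r : R) x y : ball c r `<=` Om -> (exists F, primitive_on P Q (ball c r) F) ->
    ball c r x -> ball c r y -> B x -> B y.
  move=> cO [F pF] cx cy [_ [v xv]]; split; first exact: cO.
  by exists (v + (F y - F x)); exact: path_integral_extend pF cO cx cy xv.
apply: cOm.
- exists p; split=> //; exists 0, (fun=> p); split.
    by split=> // s; exact: cvg_cst.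
  by exists 0%N => k _; rewrite /path_sum big1 // => i _; exact: incrementxx exOm Op.
- exists B; last by rewrite eqEsubset; split=> [x [Ox Bx]|x []].
  rewrite openE => x Bx; have [r [r0 rO rF]] := exOm _ Bx.1.
  apply/nbhs_ballP; exists r => //= y xy.
  exact: ext rO rF (ballxx _ r0) xy Bx.
- exists (closure B); first exact: closed_closure.
  rewrite eqEsubset; split=> [x Bx|x [Ox clBx]].
    by split; [exact: Bx.1|exact: subset_closure].
  have [r [r0 rO rF]] := exOm _ Ox.
  have [y [By xy]] := clBx _ (nbhsx_ballx x r r0).
  exact: ext rO rF xy (ballxx _ r0) By.
Qed.

(** On a simply connected domain the integral from a base point does not
    depend on the path, since two paths with the same ends form a loop. *)
Lemma global_primitive Om : simply_connected_domain Om -> locally_exact Om ->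
  exists F, primitive_on P Q Om F.
Proof.
move=> [oOm [p Op] cOm scOm] exOm.
have /choice[F HF] q : exists v, Om q -> path_integral Om p q v.
  have [Oq|nOq] := pselect (Om q); last by exists 0.
  by have [v Hv] := path_integral_exists oOm cOm exOm Op Oq; exists v.
exists F => z Oz; have [r [r0 rO [G pG]]] := exOm _ Oz.
have FG : {near z, (fun y => G y + (F z - G z)) =1 F}.
  near=> y; have zy : ball z r y by near: y; exact: nbhsx_ballx.
  have := path_integral_extend pG rO (ballxx _ r0) zy (HF _ Oz).
  move/(path_integral_unique scOm exOm (HF _ (rO _ zy))) => ->.
  by rewrite addrCA addrA; ring.
have [dG DG] := pG _ (ballxx z r0).
have dGc : differentiable (fun y => G y + (F z - G z)) z.
  by apply: differentiableD => //; exact: differentiable_cst.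
split; first exact: near_eq_diff FG dGc.
move=> v; rewrite -(near_eq_derive v FG) -DG.
rewrite (@deriveD _ _ _ G (cst (F z - G z))) //.
- by rewrite derive_cst addr0.
- exact: diff_derivable.
Unshelve. all: by end_near. Qed.

End GlobalPrimitive.

(** * Lagrangian frames in four-space *)

Lemma eq_cV4 {K : Type} (p q : 'cV[K]_4) :
  p (inord 0) 0 = q (inord 0) 0 -> p (inord 1) 0 = q (inord 1) 0 ->
  p (inord 2) 0 = q (inord 2) 0 -> p (inord 3) 0 = q (inord 3) 0 -> p = q.
Proof.
move=> e0 e1 e2 e3; apply/colP => j.
have -> : j = inord j by rewrite inord_val.
by have := ltn_ord j; move: (j : nat) => [|[|[|[|]]]].
Qed.

Lemma sum4 {K : nmodType} (F : 'I_4 -> K) :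
  \sum_i F i = F (inord 0) + F (inord 1) + F (inord 2) + F (inord 3).
Proof.
rewrite !big_ord_recl big_ord0 addr0 !addrA.
by congr (_ + _ + _ + _); congr F; apply: val_inj; rewrite /= ?inordK.
Qed.

Lemma cvec4E {K : Type} (c1 c2 c3 c4 : K) :
  (cvec4 c1 c2 c3 c4 (inord 0) 0 = c1) * (cvec4 c1 c2 c3 c4 (inord 1) 0 = c2) *
  (cvec4 c1 c2 c3 c4 (inord 2) 0 = c3) * (cvec4 c1 c2 c3 c4 (inord 3) 0 = c4).
Proof. by rewrite /cvec4 !mxE !inordK. Qed.

Lemma mul_LiE {K : pzRingType} (u : 'cV[K]_4) :
  ((Li K *m u) (inord 0) 0 = - u (inord 1) 0) *
  ((Li K *m u) (inord 1) 0 = u (inord 0) 0) *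
  ((Li K *m u) (inord 2) 0 = - u (inord 3) 0) *
  ((Li K *m u) (inord 3) 0 = u (inord 2) 0).
Proof.
rewrite !mxE !sum4 !mxE !inordK //=.
by rewrite !mul0r !mulN1r !mul1r ?addr0 ?add0r.
Qed.

Section EuclideanFourSpace.
Context {R : realType}.
Implicit Types (p q : 'cV[R]_4) (t s : R).

(** Multiplication by exp (i t) on C^2, which is R^4 with complex structure
    Li. *)
Definition rotLi t p : 'cV[R]_4 := cos t *: p + sin t *: (Li R *m p).

(** The conjugate-linear map (w1, w2) |-> (- conj w2, conj w1) of C^2. It is a
    complex structure that anticommutes with Li, and epsilon and Li epsilon-bar
    span its i-eigenspace. *)
Definition J p : 'cV[R]_4 := cvec4 (- x3 p) (x4 p) (x1 p) (- x2 p).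

Lemma JE p : (J p (inord 0) 0 = - p (inord 2) 0) * (J p (inord 1) 0 = p (inord 3) 0) *
  (J p (inord 2) 0 = p (inord 0) 0) * (J p (inord 3) 0 = - p (inord 1) 0).
Proof. by rewrite /J !cvec4E. Qed.

Lemma rotLiE t p :
  (rotLi t p (inord 0) 0 = cos t * p (inord 0) 0 - sin t * p (inord 1) 0) *
  (rotLi t p (inord 1) 0 = cos t * p (inord 1) 0 + sin t * p (inord 0) 0) *
  (rotLi t p (inord 2) 0 = cos t * p (inord 2) 0 - sin t * p (inord 3) 0) *
  (rotLi t p (inord 3) 0 = cos t * p (inord 3) 0 + sin t * p (inord 2) 0).
Proof.
have E (k : 'I_4) : rotLi t p k 0 = cos t * p k 0 + sin t * (Li R *m p) k 0.
  by rewrite [LHS]mxE [X in X + _]mxE [X in _ + X]mxE.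
by rewrite !E !mul_LiE !mulrN.
Qed.

Lemma rotLiD t s p : rotLi t (rotLi s p) = rotLi (t + s) p.
Proof. by apply: eq_cV4; rewrite !rotLiE cosD sinD; ring. Qed.

Lemma rotLi0 p : rotLi 0 p = p.
Proof. by rewrite /rotLi cos0 sin0 scale1r scale0r addr0. Qed.

Lemma J_rotLi t p : J (rotLi t p) = rotLi (- t) (J p).
Proof. by apply: eq_cV4; rewrite !(JE, rotLiE) cosN sinN; ring. Qed.

Lemma rotLi_linear t : linear (rotLi t).
Proof.
by move=> k p q; apply: eq_cV4; rewrite !(rotLiE, mxE); ring.
Qed.

Lemma J_linear : linear J.
Proof.
by move=> k p q; apply: eq_cV4; rewrite !(JE, mxE); ring.
Qed.

HB.instance Definition _ t :=
  GRing.isLinear.Build R 'cV[R]_4 'cV[R]_4 _ (rotLi t) (rotLi_linear t).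
HB.instance Definition _ :=
  GRing.isLinear.Build R 'cV[R]_4 'cV[R]_4 _ J J_linear.

Lemma innerE p q : inner p q =
  x1 p * x1 q + x2 p * x2 q + x3 p * x3 q + x4 p * x4 q.
Proof. by rewrite /inner mxE sum4 !mxE. Qed.

Lemma inner_ge0 p : 0 <= inner p p.
Proof. by rewrite innerE -!expr2 !addr_ge0 ?sqr_ge0. Qed.

Lemma inner_eq0 p : inner p p = 0 -> p = 0.
Proof.
move=> /eqP; rewrite innerE -!expr2 !paddr_eq0 ?addr_ge0 ?sqr_ge0 // !sqrf_eq0.
move=> /andP[/andP[/andP[/eqP e1 /eqP e2] /eqP e3] /eqP e4].
by apply: eq_cV4; rewrite mxE.
Qed.

Lemma enormM p : enorm p * enorm p = inner p p.
Proof. by rewrite -expr2 sqr_sqrtr // inner_ge0. Qed.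

Lemma cosMcosDsinMsin t : cos t * cos t + sin t * sin t = 1.
Proof. by rewrite -!expr2 cos2Dsin2. Qed.

Lemma inner_rotLi t p q : inner (rotLi t p) (rotLi t q) = inner p q.
Proof.
rewrite !innerE /x1 /x2 /x3 /x4 !rotLiE.
rewrite -[RHS]mul1r -(cosMcosDsinMsin t); ring.
Qed.

Lemma inner_J p q : inner (J p) (J q) = inner p q.
Proof. by rewrite !innerE /x1 /x2 /x3 /x4 !JE; ring. Qed.

(** The hermitian product of rotLi t (J p) with q is exp (- i t) times the
    holomorphic volume of (p, q). The hypotheses make it as large as the
    Cauchy-Schwarz inequality allows, so q - rotLi t (J p) has length zero. *)
Lemma frame_from_angle p q t :
  enorm p = enorm q ->
  hol_volume p q = real_complex R (enorm p * enorm q) * expi t ->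
  q = rotLi t (J p).
Proof.
move=> pq; rewrite -pq enormM => E.
have E' : inner p p = inner q q by rewrite -!enormM pq.
have [ER EI] : complex.Re (hol_volume p q) = inner p p * cos t /\
    complex.Im (hol_volume p q) = inner p p * sin t.
  by rewrite E /expi /=; split; ring.
apply/subr0_eq/inner_eq0.
have -> : inner (q - rotLi t (J p)) (q - rotLi t (J p)) =
    inner q q + inner (rotLi t (J p)) (rotLi t (J p)) -
    2 * (cos t * complex.Re (hol_volume p q) + sin t * complex.Im (hol_volume p q)).
  have sE k : (q - rotLi t (J p)) k 0 = q k 0 - rotLi t (J p) k 0.
    by rewrite [LHS]mxE [X in _ + X]mxE.
  by rewrite !innerE /hol_volume /wedge_form /= /x1 /x2 /x3 /x4 !sE !(rotLiE, JE); ring.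
rewrite inner_rotLi inner_J ER EI -E'.
by rewrite [cos t * _]mulrCA [sin t * _]mulrCA -mulrDr cosMcosDsinMsin; ring.
Qed.

Lemma angle_of_frame p t :
  [/\ enorm (rotLi t (J p)) = enorm p, inner p (rotLi t (J p)) = 0,
      omega p (rotLi t (J p)) = 0 &
      hol_volume p (rotLi t (J p)) = real_complex R (inner p p) * expi t].
Proof.
split.
- by rewrite /enorm inner_rotLi inner_J.
- by rewrite innerE /x1 /x2 /x3 /x4 !(rotLiE, JE); ring.
- by rewrite /omega /wedge_form /x1 /x2 /x3 /x4 !(rotLiE, JE); ring.
- rewrite innerE /expi /hol_volume /wedge_form /x1 /x2 /x3 /x4 !(rotLiE, JE).
  by apply/eqP; rewrite eq_complex /=; apply/andP; split; apply/eqP; ring.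
Qed.

End EuclideanFourSpace.

(** * The exponential of Li *)

Section MatrixExponential.
Context {R : realType}.

Definition rotmx (t : R) : 'M[R]_4 := (cos t)%:M + sin t *: Li R.

Lemma mul_rotmx t p : rotmx t *m p = rotLi t p.
Proof. by rewrite /rotmx mulmxDl mul_scalar_mx -scalemxAl. Qed.

Lemma Li_sqr : Li R *m Li R = (- 1)%:M.
Proof.
apply/matrixP => i j; rewrite !mxE sum4 !mxE !inordK //.
case: i j => [[|[|[|[|//]]]] ?] [[|[|[|[|//]]]] ?]; rewrite /= ?mulr1n ?mulr0n; ring.
Qed.

Lemma exp_LiE (t : R) k : (t *: Li R) ^+ k =
  if odd k then ((-1) ^+ k./2 * t ^+ k) *: Li R
  else ((-1) ^+ k./2 * t ^+ k)%:M.
Proof.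
elim: k => [|k IHk]; first by rewrite !expr0 mulr1.
rewrite exprS IHk /= uphalf_half; case: (odd k) => /=.
  rewrite -[_ * _]/(_ *m _) -scalemxAl -scalemxAr Li_sqr scalerA scale_scalar_mx.
  by congr _%:M; rewrite exprS add1n exprS; ring.
rewrite -[_ * _]/(_ *m _) mul_mx_scalar scalerA add0n exprS.
by congr (_ *: _); ring.
Qed.

Lemma expmx_term (t : R) k : (k`!%:R)^-1 *: (t *: Li R) ^+ k =
  (cos_coeff t k)%:M + sin_coeff t k *: Li R.
Proof.
rewrite exp_LiE /cos_coeff /sin_coeff /=; case: ifPn => ok /=.
  have -> : k.-1./2 = k./2 by case: k ok => //= k ok; rewrite uphalf_half (negbTE ok).
  by rewrite !mul0r raddf0 add0r scalerA mul1r [_ / _]mulrC.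
rewrite !mul0r scale0r addr0 scale_scalar_mx mul1r.
by congr _%:M; rewrite [RHS]mulrC.
Qed.

Lemma expmx_LiE (t : R) : expmx (t *: Li R) = rotmx t.
Proof.
apply: cvg_lim => //.
have -> : (fun n => \sum_(k < n) (k`!%:R)^-1 *: (t *: Li R) ^+ k) =
    (fun n => series (cos_coeff t) n *: 1%:M + series (sin_coeff t) n *: Li R).
  apply/funext => n; rewrite /series /= !big_mkord !scaler_suml -big_split /=.
  by apply: eq_bigr => k _; rewrite expmx_term scalemx1.
rewrite /rotmx -[(cos t)%:M]scalemx1; apply: cvgD.
  have cc : series (cos_coeff t) @ \oo --> cos t.
    by rewrite unlock; exact: is_cvg_series_cos_coeff.
  exact: cvgZr_tmp cc.
have cs : series (sin_coeff t) @ \oo --> sin t.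
  by rewrite unlock; exact: is_cvg_series_sin_coeff.
exact: cvgZr_tmp cs.
Qed.

Lemma mul_expmx_Li (t : R) (p : 'cV[R]_4) : expmx (t *: Li R) *m p = rotLi t p.
Proof. by rewrite expmx_LiE mul_rotmx. Qed.

End MatrixExponential.

(** * Mixed derivatives and closed forms *)

Section ClosedForms.
Context {R : realType}.
Implicit Types (Om : set (R * R)) (P Q F : R * R -> R) (z v h : R * R).

Lemma smooth_continuous {W : normedModType R} Om (F : R * R -> W) z :
  smooth Om F -> Om z -> {for z, continuous F}.
Proof. by move=> sF Oz; apply: differentiable_continuous; exact: smooth_diff sF Oz. Qed.

(** The mean value inequality in each variable, applied to the difference of
    f and the model A s w. *)
Lemma second_difference (f fx fxy : R -> R -> R) (x y t A e : R) : 0 < t ->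
  (forall s w, `|s - x| <= t -> `|w - y| <= t ->
     [/\ is_derive s (1 : R) (f^~ w) (fx s w),
         is_derive w (1 : R) (fx s) (fxy s w) & `|fxy s w - A| <= e]) ->
  `|f (x + t) (y + t) - f x (y + t) - f (x + t) y + f x y - A * t * t|
    <= e * t * t.
Proof.
move=> t0 H.
have tt : `|t| <= t by rewrite gtr0_norm.
have z0 (u : R) : `|u - u| <= t by rewrite subrr normr0 ltW.
pose G s := f s (y + t) - f s y - A * t * s.
have -> : f (x + t) (y + t) - f x (y + t) - f (x + t) y + f x y - A * t * t =
    G (x + t) - G x by rewrite /G; ring.
have := @mean_value_bound R G
  (fun s => fx s (y + t) - fx s y - A * t) x (x + t) (e * t).
rewrite [x + t]addrC addrK gtr0_norm //; apply=> s st.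
  have ty : `|y + t - y| <= t by rewrite addrAC subrr add0r.
  have [d1 _ _] := H s _ st ty; have [d2 _ _] := H s _ st (z0 y).
  exact: is_derive_fsub (is_derive_fsub d1 d2) (is_derive_linear _ _).
pose K w := fx s w - A * w.
have -> : fx s (y + t) - fx s y - A * t = K (y + t) - K y by rewrite /K; ring.
have := @mean_value_bound R K (fun w => fxy s w - A) y (y + t) e.
rewrite [y + t]addrC addrK gtr0_norm //; apply=> w wt.
  have [_ d _] := H s w st wt.
  exact: is_derive_fsub d (is_derive_linear _ _).
by have [] := H s w st wt.
Qed.

(** Schwarz's theorem: both mixed derivatives are the limit of the same second
    difference over small squares. *)
Lemma mixed_derivatives Om (f : R * R -> R) z : open Om -> smooth Om f -> Om z ->
  'D_(@e_y R) ('D_(@e_x R) f) z = 'D_(@e_x R) ('D_(@e_y R) f) z.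
Proof.
move=> oOm sf; case: z => x y Oz.
have [sx sy] := (smooth_derive (@e_x R) sf, smooth_derive (@e_y R) sf).
have [sxy syx] := (smooth_derive (@e_y R) sx, smooth_derive (@e_x R) sy).
set A := LHS; set B := RHS.
apply/eqP; rewrite -subr_eq0 -normr_le0; apply/ler_addgt0Pr => e' e'0.
rewrite add0r; pose e := e' / 2; have e0 : 0 < e by rewrite divr_gt0.
have [d1 d10 H1] := continuous_dist (smooth_continuous sxy Oz) e0.
have [d2 d20 H2] := continuous_dist (smooth_continuous syx Oz) e0.
have /nbhs_ballP[d3 /= d30 H3] := open_nbhs_nbhs (conj oOm Oz).
pose d := Num.min d1 (Num.min d2 d3).
have d0 : 0 < d by rewrite !lt_min d10 d20 d30.
pose t := d / 2; have t0 : 0 < t by rewrite divr_gt0.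
have close s w : `|s - x| <= t -> `|w - y| <= t ->
    [/\ Om (s, w), `|'D_(@e_y R) ('D_(@e_x R) f) (s, w) - A| <= e &
        `|'D_(@e_x R) ('D_(@e_y R) f) (s, w) - B| <= e].
  move=> st wt; have : `|(s, w) - (x, y)| < d.
    rewrite prod_normE gt_max /=.
    have td : t < d by rewrite ltr_pdivrMr // ltr_pMr // ltr1n.
    by rewrite (le_lt_trans st td) (le_lt_trans wt td).
  rewrite !lt_min => /andP[n1 /andP[n2 n3]]; split; [|exact: H1|exact: H2].
  by apply: H3; rewrite -ball_normE /= distrC.
have E1 := @second_difference (fun s w => f (s, w))
  (fun s w => 'D_(@e_x R) f (s, w))
  (fun s w => 'D_(@e_y R) ('D_(@e_x R) f) (s, w)) x y t A e t0.
have E2 := @second_difference (fun w s => f (s, w))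
  (fun w s => 'D_(@e_y R) f (s, w))
  (fun w s => 'D_(@e_x R) ('D_(@e_y R) f) (s, w)) y x t B e t0.
have h1 s w : `|s - x| <= t -> `|w - y| <= t ->
    [/\ is_derive s (1 : R) (fun s => f (s, w)) ('D_(@e_x R) f (s, w)),
        is_derive w (1 : R) (fun w => 'D_(@e_x R) f (s, w))
          ('D_(@e_y R) ('D_(@e_x R) f) (s, w)) &
        `|'D_(@e_y R) ('D_(@e_x R) f) (s, w) - A| <= e].
  move=> st wt; have [Osw Asw _] := close s w st wt; split; last exact: Asw.
    by apply: is_derive_horizontal; exact: smooth_diff sf Osw.
  by apply: is_derive_vertical; exact: smooth_diff sx Osw.
have h2 w s : `|w - y| <= t -> `|s - x| <= t ->
    [/\ is_derive w (1 : R) (fun w => f (s, w)) ('D_(@e_y R) f (s, w)),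
        is_derive s (1 : R) (fun s => 'D_(@e_y R) f (s, w))
          ('D_(@e_x R) ('D_(@e_y R) f) (s, w)) &
        `|'D_(@e_x R) ('D_(@e_y R) f) (s, w) - B| <= e].
  move=> wt st; have [Osw _ Bsw] := close s w st wt; split; last exact: Bsw.
    by apply: is_derive_vertical; exact: smooth_diff sf Osw.
  by apply: is_derive_horizontal; exact: smooth_diff sy Osw.
move: (E1 h1) (E2 h2) => {}E1 {}E2; clearbody A B; clear -E1 E2 t0 e'0.
have tt0 : 0 < t * t by rewrite mulr_gt0.
rewrite -(ler_pM2r tt0) -{1}(gtr0_norm tt0) -normrM.
rewrite distrC in E1; have := le_trans (ler_normD _ _) (lerD E2 E1).
have -> : e * t * t + e * t * t = e' * (t * t) by rewrite /e; field.
apply: le_trans; rewrite le_eqVlt; apply/orP; left; apply/eqP.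
by congr `|_|; ring.
Qed.

Lemma closed_form_exact Om P Q : simply_connected_domain Om ->
  smooth Om P -> smooth Om Q ->
  (forall z, Om z -> 'D_(@e_y R) P z = 'D_(@e_x R) Q z) ->
  exists F, smooth Om F /\
    forall z, Om z -> forall v, 'D_v F z = P z * v.1 + Q z * v.2.
Proof.
move=> sc sP sQ PQ; have [oOm _ _ _] := sc.
have exOm : locally_exact P Q Om.
  move=> p Op; have [r [r0 [F pF]]] := local_primitive oOm Op
    (fun z Oz => smooth_diff sP Oz) (fun z Oz => smooth_diff sQ Oz) PQ
    (fun z Oz => smooth_continuous (smooth_derive _ sP) Oz).
  have /nbhs_ballP[r' /= r'0 rO] := open_nbhs_nbhs (conj oOm Op).
  exists (Num.min r r'); split; first by rewrite lt_min r0.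
    by move=> q pq; apply: rO; apply: le_ball pq; rewrite ge_min lexx orbT.
  exists F; apply: primitive_on_subset pF; apply: le_ball.
  by rewrite ge_min lexx.
have [F pF] := global_primitive sc exOm; exists F; split; last first.
  by move=> z Oz v; have [_ ->] := pF z Oz.
apply: smooth_of_derive => [z Oz|v]; first by have [] := pF z Oz.
have s1 : smooth Om (fun z => P z * v.1 + Q z * v.2).
  by apply: smoothD => //; apply: smoothM => //; exact: smooth_cst.
by apply: smooth_eq s1 => // z Oz; have [_ ->] := pF z Oz.
Qed.

End ClosedForms.

(** * The form exp (i beta / 2) (P dx + J P dy) *)

Section RotatingFrames.
Context {R : realType}.
Implicit Types (Om : set (R * R)) (f g theta beta : R * R -> R) (z v h : R * R).
Implicit Types (P X : R * R -> 'cV[R]_4).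

Lemma derive_fM f g z v : differentiable f z -> differentiable g z ->
  'D_v (fun y => f y * g y) z = f z * 'D_v g z + g z * 'D_v f z.
Proof. by move=> df dg; apply: deriveM; exact: diff_derivable. Qed.

Lemma derive_fD f g z v : differentiable f z -> differentiable g z ->
  'D_v (fun y => f y + g y) z = 'D_v f z + 'D_v g z.
Proof. by move=> df dg; apply: deriveD; exact: diff_derivable. Qed.

Lemma derive_fN f z v : differentiable f z ->
  'D_v (fun y => - f y) z = - 'D_v f z.
Proof. by move=> df; apply: deriveN; exact: diff_derivable. Qed.

Lemma derive_cosM theta f z v : differentiable theta z -> differentiable f z ->
  differentiable (fun y => cos (theta y) * f y) z /\
  'D_v (fun y => cos (theta y) * f y) z =
    cos (theta z) * 'D_v f z - sin (theta z) * ('D_v theta z * f z).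
Proof.
move=> dt df.
have [dc Dc] := derive_comp1 v (is_derive_cos (theta z)) dt.
split; first exact: differentiableM.
by rewrite (derive_fM v dc df) /= Dc; ring.
Qed.

Lemma derive_sinM theta f z v : differentiable theta z -> differentiable f z ->
  differentiable (fun y => sin (theta y) * f y) z /\
  'D_v (fun y => sin (theta y) * f y) z =
    sin (theta z) * 'D_v f z + cos (theta z) * ('D_v theta z * f z).
Proof.
move=> dt df.
have [dc Dc] := derive_comp1 v (is_derive_sin (theta z)) dt.
split; first exact: differentiableM.
by rewrite (derive_fM v dc df) /= Dc; ring.
Qed.

Lemma derive_rotLi theta P z v : differentiable theta z -> differentiable P z ->
  'D_v (fun y => rotLi (theta y) (P y)) z =
    rotLi (theta z) ('D_v P z + 'D_v theta z *: (Li R *m P z)).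
Proof.
move=> dt dP.
have dPk k : differentiable (fun y => P y k 0) z by exact: differentiable_mxcoord.
have plus f g : differentiable f z -> differentiable g z ->
    differentiable (fun y => cos (theta y) * f y + sin (theta y) * g y) z /\
    'D_v (fun y => cos (theta y) * f y + sin (theta y) * g y) z =
    cos (theta z) * ('D_v f z + 'D_v theta z * g z) +
    sin (theta z) * ('D_v g z - 'D_v theta z * f z).
  move=> df dg; have [d1 D1] := derive_cosM v dt df.
  have [d2 D2] := derive_sinM v dt dg; split; first exact: differentiableD.
  by rewrite derive_fD // D1 D2; ring.
have minus f g : differentiable f z -> differentiable g z ->
    differentiable (fun y => cos (theta y) * f y - sin (theta y) * g y) z /\
    'D_v (fun y => cos (theta y) * f y - sin (theta y) * g y) z =
    cos (theta z) * ('D_v f z - 'D_v theta z * g z) -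
    sin (theta z) * ('D_v g z + 'D_v theta z * f z).
  move=> df dg; have [d1 D1] := derive_cosM v dt df.
  have [d2 D2] := derive_sinM v dt dg; split; first exact: differentiableB.
  rewrite derive_fD //; last exact: differentiableN.
  by rewrite derive_fN // D1 D2; ring.
have E0 : (fun y => rotLi (theta y) (P y) (inord 0) 0) = fun y =>
    cos (theta y) * P y (inord 0) 0 - sin (theta y) * P y (inord 1) 0.
  by apply/funext => y; rewrite rotLiE.
have E1 : (fun y => rotLi (theta y) (P y) (inord 1) 0) = fun y =>
    cos (theta y) * P y (inord 1) 0 + sin (theta y) * P y (inord 0) 0.
  by apply/funext => y; rewrite rotLiE.
have E2 : (fun y => rotLi (theta y) (P y) (inord 2) 0) = fun y =>
    cos (theta y) * P y (inord 2) 0 - sin (theta y) * P y (inord 3) 0.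
  by apply/funext => y; rewrite rotLiE.
have E3 : (fun y => rotLi (theta y) (P y) (inord 3) 0) = fun y =>
    cos (theta y) * P y (inord 3) 0 + sin (theta y) * P y (inord 2) 0.
  by apply/funext => y; rewrite rotLiE.
have drot : differentiable (fun y => rotLi (theta y) (P y)) z.
  apply: differentiable_cV => i; rewrite -(inord_val i).
  have := ltn_ord i; move: (i : nat) => [|[|[|[|//]]]] _.
  - by rewrite E0; apply: (minus _ _ (dPk _) (dPk _)).1.
  - by rewrite E1; apply: (plus _ _ (dPk _) (dPk _)).1.
  - by rewrite E2; apply: (minus _ _ (dPk _) (dPk _)).1.
  - by rewrite E3; apply: (plus _ _ (dPk _) (dPk _)).1.
have rhs (k : 'I_4) : ('D_v P z + 'D_v theta z *: (Li R *m P z)) k 0 =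
    'D_v P z k 0 + 'D_v theta z * (Li R *m P z) k 0.
  by rewrite [LHS]mxE [X in _ + X]mxE.
apply: eq_cV4; rewrite -derive_coord // rotLiE !rhs !mul_LiE -!derive_coord //.
- by rewrite E0 (minus _ _ (dPk _) (dPk _)).2; ring.
- by rewrite E1 (plus _ _ (dPk _) (dPk _)).2; ring.
- by rewrite E2 (minus _ _ (dPk _) (dPk _)).2; ring.
- by rewrite E3 (plus _ _ (dPk _) (dPk _)).2; ring.
Qed.

Lemma derive_J P z v : differentiable P z ->
  differentiable (fun y => J (P y)) z /\
  'D_v (fun y => J (P y)) z = J ('D_v P z).
Proof.
move=> dP.
have dPk k : differentiable (fun y => P y k 0) z by exact: differentiable_mxcoord.
have E0 : (fun y => J (P y) (inord 0) 0) = fun y => - P y (inord 2) 0.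
  by apply/funext => y; rewrite JE.
have E1 : (fun y => J (P y) (inord 1) 0) = fun y => P y (inord 3) 0.
  by apply/funext => y; rewrite JE.
have E2 : (fun y => J (P y) (inord 2) 0) = fun y => P y (inord 0) 0.
  by apply/funext => y; rewrite JE.
have E3 : (fun y => J (P y) (inord 3) 0) = fun y => - P y (inord 1) 0.
  by apply/funext => y; rewrite JE.
have dJ : differentiable (fun y => J (P y)) z.
  apply: differentiable_cV => i; rewrite -(inord_val i).
  have := ltn_ord i; move: (i : nat) => [|[|[|[|//]]]] _.
  - by rewrite E0; exact: differentiableN.
  - by rewrite E1.
  - by rewrite E2.
  - by rewrite E3; exact: differentiableN.
split=> //; apply: eq_cV4; rewrite -derive_coord // JE -!derive_coord //.
- by rewrite E0 derive_fN.
- by rewrite E1.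
- by rewrite E2.
- by rewrite E3 derive_fN.
Qed.

Lemma smooth_J Om P : open Om -> smooth Om P -> smooth Om (fun z => J (P z)).
Proof.
move=> oOm sP; apply: smooth_cV => // i; rewrite -(inord_val i).
have sk k := smooth_coord k 0 oOm sP.
have := ltn_ord i; move: (i : nat) => [|[|[|[|//]]]] _.
- by apply: smooth_eq (smoothN oOm (sk (inord 2))) => // z _; rewrite JE.
- by apply: smooth_eq (sk (inord 3)) => // z _; rewrite JE.
- by apply: smooth_eq (sk (inord 0)) => // z _; rewrite JE.
- by apply: smooth_eq (smoothN oOm (sk (inord 1))) => // z _; rewrite JE.
Qed.

Lemma smooth_rotLi Om theta P : open Om -> smooth Om theta -> smooth Om P ->
  smooth Om (fun z => rotLi (theta z) (P z)).
Proof.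
move=> oOm st sP; apply: smooth_cV => // i; rewrite -(inord_val i).
have [sc ss] := (smooth_cos oOm st, smooth_sin oOm st).
have sk k := smooth_coord k 0 oOm sP.
have cs k l := smoothD oOm (smoothM oOm sc (sk k)) (smoothM oOm ss (sk l)).
have cms k l := smoothD oOm (smoothM oOm sc (sk k)) (smoothN oOm (smoothM oOm ss (sk l))).
have := ltn_ord i; move: (i : nat) => [|[|[|[|//]]]] _.
- by apply: smooth_eq (cms (inord 0) (inord 1)) => // z _; rewrite rotLiE.
- by apply: smooth_eq (cs (inord 1) (inord 0)) => // z _; rewrite rotLiE.
- by apply: smooth_eq (cms (inord 2) (inord 3)) => // z _; rewrite rotLiE.
- by apply: smooth_eq (cs (inord 3) (inord 2)) => // z _; rewrite rotLiE.
Qed.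

(** The equality of mixed derivatives of a map X as in frame_eq, with the
    rotation cancelled on both sides (real_dirac_closed). In complex notation
    it is the Dirac equation (dirac_frame). *)
Definition real_dirac beta P z : Prop :=
  'D_(@e_y R) P z + ('D_(@e_y R) beta z / 2) *: (Li R *m P z) =
  J ('D_(@e_x R) P z) + ('D_(@e_x R) beta z / 2) *: (Li R *m J (P z)).

(** The equation for dX in real notation (dX_equation_frame). *)
Definition frame_eq beta P X z : Prop := forall h,
  'd X z h = h.1 *: rotLi (beta z / 2) (P z) + h.2 *: rotLi (beta z / 2) (J (P z)).

Lemma smooth_half Om beta : open Om -> smooth Om beta ->
  smooth Om (fun z => beta z / 2).
Proof. by move=> oOm sb; apply: smoothM => //; exact: smooth_cst. Qed.

Lemma derive_half beta z v : differentiable beta z ->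
  'D_v (fun y => beta y / 2) z = 'D_v beta z / 2.
Proof.
move=> db; have dc : differentiable (cst 2^-1 : R * R -> R) z.
  exact: differentiable_cst.
rewrite (derive_fM v db dc) derive_cst mulr0 add0r mulrC //.
Qed.

(** By derive_rotLi both derivatives are rotations of the two sides of
    real_dirac by the same angle. *)
Lemma real_dirac_closed Om beta P z : open Om -> smooth Om beta -> smooth Om P ->
  Om z ->
  real_dirac beta P z <->
  'D_(@e_y R) (fun y => rotLi (beta y / 2) (P y)) z =
  'D_(@e_x R) (fun y => rotLi (beta y / 2) (J (P y))) z.
Proof.
move=> oOm sb sP Oz.
have [db dP] := (smooth_diff sb Oz, smooth_diff sP Oz).
have dh := smooth_diff (smooth_half oOm sb) Oz.
have [dJ DJ] := derive_J (@e_x R) dP.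
rewrite derive_rotLi // derive_rotLi // !derive_half // DJ; split=> [-> //|E].
apply: (can_inj (g := rotLi (- (beta z / 2)))) E => p.
by rewrite rotLiD addNr rotLi0.
Qed.

Lemma frame_eq_derive beta P X z : differentiable X z -> frame_eq beta P X z ->
  'D_(@e_x R) X z = rotLi (beta z / 2) (P z) /\
  'D_(@e_y R) X z = rotLi (beta z / 2) (J (P z)).
Proof.
move=> dX fX; rewrite !deriveE // !fX /=.
by rewrite !scale1r !scale0r addr0 add0r.
Qed.

(** The form is exact here, being dX, hence closed. *)
Lemma frame_eq_dirac Om beta P X : open Om -> smooth Om beta -> smooth Om P ->
  smooth Om X -> (forall z, Om z -> frame_eq beta P X z) ->
  forall z, Om z -> real_dirac beta P z.
Proof.
move=> oOm sb sP sX fX z Oz; apply/(real_dirac_closed oOm sb sP Oz).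
have D y : Om y -> 'D_(@e_x R) X y = rotLi (beta y / 2) (P y) /\
    'D_(@e_y R) X y = rotLi (beta y / 2) (J (P y)).
  by move=> Oy; apply: frame_eq_derive (fX _ Oy); exact: smooth_diff sX Oy.
rewrite -(derive_eq_on _ oOm (fun y Oy => (D y Oy).1) Oz).
rewrite -(derive_eq_on _ oOm (fun y Oy => (D y Oy).2) Oz).
have [sXx sXy] := (smooth_derive (@e_x R) sX, smooth_derive (@e_y R) sX).
apply/colP => i.
have [dXx dXy] := (smooth_diff sXx Oz, smooth_diff sXy Oz).
have Kx := derive_coord i 0 (@e_y R) dXx; have Ky := derive_coord i 0 (@e_x R) dXy.
apply: etrans (esym Kx) _; apply: etrans Ky.
have := mixed_derivatives oOm (smooth_coord i 0 oOm sX) Oz.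
have Dk v y : Om y -> 'D_v (fun y => X y i 0) y = 'D_v X y i 0.
  by move=> Oy; apply: derive_coord; exact: smooth_diff sX Oy.
rewrite (derive_eq_on _ oOm (Dk (@e_x R)) Oz).
by rewrite (derive_eq_on _ oOm (Dk (@e_y R)) Oz).
Qed.

Lemma frame_integrable Om beta P : simply_connected_domain Om ->
  smooth Om beta -> smooth Om P -> (forall z, Om z -> real_dirac beta P z) ->
  exists X, smooth Om X /\ forall z, Om z -> frame_eq beta P X z.
Proof.
move=> sc sb sP dP; have [oOm _ _ _] := sc.
have sh := smooth_half oOm sb.
have sA := smooth_rotLi oOm sh sP; have sB := smooth_rotLi oOm sh (smooth_J oOm sP).
have /choice[F HF] (i : 'I_4) : exists F, smooth Om F /\
    forall z, Om z -> forall v, 'D_v F z =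
      rotLi (beta z / 2) (P z) i 0 * v.1 + rotLi (beta z / 2) (J (P z)) i 0 * v.2.
  apply: closed_form_exact => //; [exact: smooth_coord|exact: smooth_coord|].
  move=> z Oz.
  rewrite !derive_coord; [|exact: smooth_diff sB Oz|exact: smooth_diff sA Oz].
  by rewrite (proj1 (real_dirac_closed oOm sb sP Oz) (dP _ Oz)).
exists (fun z => \col_i F i z).
have cE i : (fun z => (\col_i F i z) i 0) = F i by apply/funext => z; rewrite mxE.
have sX : smooth Om (fun z => \col_i F i z).
  by apply: smooth_cV => // i; rewrite cE; have [] := HF i.
split=> // z Oz h; have dX := smooth_diff sX Oz.
apply/colP => i; rewrite -deriveE // -derive_coord // cE.
have [_ ->] := HF i; last by [].
rewrite [RHS]mxE [X in _ = X + _]mxE [X in _ = _ + X]mxE.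
by rewrite [h.1 * _]mulrC [h.2 * _]mulrC.
Qed.

End RotatingFrames.

(** * Spinors in real notation *)

Section ComplexNotation.
Context {R : realType}.
Implicit Types (Om : set (R * R)) (z v h : R * R) (beta : R * R -> R).
Implicit Types (a b c : R * R -> R[i]) (P X : R * R -> 'cV[R]_4).
Local Open Scope complex_scope.

(** The vector P for which spinor a b is (P - i J P) / 2 (spinor_frame). *)
Definition frame a b z : 'cV[R]_4 :=
  cvec4 (complex.Re (a z)) (complex.Re (b z)) (complex.Im (a z))
    (- complex.Im (b z)).

Lemma half_complex : (2%:R^-1 : R[i]) = (2^-1)%:C.
Proof. by rewrite fmorphV rmorph_nat. Qed.

Lemma spinorE a b z :
  (spinor a b z (inord 0) 0 = 2%:R^-1 * a z) *
  (spinor a b z (inord 1) 0 = 2%:R^-1 * b z) *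
  (spinor a b z (inord 2) 0 = 2%:R^-1 * - iC R * a z) *
  (spinor a b z (inord 3) 0 = 2%:R^-1 * iC R * b z).
Proof.
have E k : spinor a b z k 0 =
    a z * (2%:R^-1 * cvec4 1 0 (- iC R) 0 k 0) + b z * (Li R[i] *m epsbar R) k 0.
  rewrite [LHS]mxE [X in X + _]mxE [X in _ + X]mxE.
  by rewrite [X in a z * X]mxE.
have Eb k : epsbar R k 0 = 2%:R^-1 * cvec4 1 0 (iC R) 0 k 0 by rewrite [LHS]mxE.
by rewrite !E !mul_LiE !Eb !cvec4E; do !split; ring.
Qed.

Lemma mxC_inj m n : injective (@mxC R m n).
Proof.
move=> A B /matrixP AB; apply/matrixP => i j.
by have := AB i j; rewrite !mxE => -[].
Qed.

Lemma spinor_frame a b z h :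
  dz h *: spinor a b z + dzbar h *: conj_vec (spinor a b z) =
  mxC (h.1 *: frame a b z + h.2 *: J (frame a b z)).
Proof.
have EL k : (dz h *: spinor a b z + dzbar h *: conj_vec (spinor a b z)) k 0 =
    dz h * spinor a b z k 0 + dzbar h * conjc (spinor a b z k 0).
  by rewrite [LHS]mxE [X in X + _]mxE [X in _ + X]mxE [X in dzbar h * X]mxE.
have ER k : mxC (h.1 *: frame a b z + h.2 *: J (frame a b z)) k 0 =
    (h.1 * frame a b z k 0 + h.2 * J (frame a b z) k 0)%:C.
  by rewrite [LHS]mxE [X in X%:C]mxE [X in (X + _)%:C]mxE [X in (_ + X)%:C]mxE.
apply: eq_cV4; rewrite EL ER spinorE ?JE /frame !cvec4E half_complex /iC /dz /dzbar;
  case: (a z) => a1 a2; case: (b z) => b1 b2;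
  by apply/eqP; rewrite eq_complex /=; apply/andP; split; apply/eqP; field.
Qed.

Lemma dX_equation_frame Om X beta a b :
  dX_equation Om X beta (spinor a b) <->
  forall z, Om z -> frame_eq beta (frame a b) X z.
Proof.
have E z h : mxC (expmx ((beta z / 2%:R) *: Li R)) *m
      (dz h *: spinor a b z + dzbar h *: conj_vec (spinor a b z)) =
    mxC (h.1 *: rotLi (beta z / 2) (frame a b z) +
         h.2 *: rotLi (beta z / 2) (J (frame a b z))).
  by rewrite spinor_frame /mxC -map_mxM mul_expmx_Li linearD !linearZ.
split=> H z Oz h; first by apply: mxC_inj; rewrite H // E.
by rewrite H // E.
Qed.

Lemma csmooth_frame Om a b : open Om -> csmooth Om a -> csmooth Om b ->
  smooth Om (frame a b).
Proof.
move=> oOm [sa1 sa2] [sb1 sb2]; apply: smooth_cV => // i; rewrite -(inord_val i).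
have := ltn_ord i; move: (i : nat) => [|[|[|[|//]]]] _.
- by apply: smooth_eq sa1 => // z _; rewrite cvec4E.
- by apply: smooth_eq sb1 => // z _; rewrite cvec4E.
- by apply: smooth_eq sa2 => // z _; rewrite cvec4E.
- by apply: smooth_eq (smoothN oOm sb2) => // z _; rewrite cvec4E.
Qed.

Lemma frame_surjective Om P : open Om -> smooth Om P ->
  exists a b, [/\ csmooth Om a, csmooth Om b & forall z, frame a b z = P z].
Proof.
move=> oOm sP; have sk k := smooth_coord k 0 oOm sP.
exists (fun z => P z (inord 0) 0 +i* P z (inord 2) 0).
exists (fun z => P z (inord 1) 0 -i* P z (inord 3) 0).
split; first by split; exact: sk.
- by split; [exact: sk|exact: smoothN (sk _)].
- by move=> z; apply: eq_cV4; rewrite cvec4E //= opprK.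
Qed.

Lemma derive_comb (f g : R * R -> R) (k l : R) z v :
  differentiable f z -> differentiable g z ->
  'D_v (fun y => k * f y + l * g y) z = k * 'D_v f z + l * 'D_v g z.
Proof.
move=> df dg.
have dk (r : R) : differentiable (cst r : R * R -> R) z by exact: differentiable_cst.
have Dm (r : R) (u : R * R -> R) : differentiable u z ->
    differentiable (fun y => r * u y) z /\ 'D_v (fun y => r * u y) z = r * 'D_v u z.
  move=> du; split; first exact: (differentiableM (dk r) du).
  by have := derive_fM v (dk r) du; rewrite derive_cst mulr0 addr0.
have [d1 D1] := Dm k f df; have [d2 D2] := Dm l g dg.
by rewrite derive_fD // D1 D2.
Qed.

Lemma cpartialZ (k : R[i]) c z v :
  differentiable (fun y => complex.Re (c y)) z ->
  differentiable (fun y => complex.Im (c y)) z ->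
  cpartial v (fun y => k * c y) z = k * cpartial v c z.
Proof.
case: k => k l d1 d2; rewrite /cpartial.
have -> : (fun y => complex.Re ((k +i* l) * c y)) =
    (fun y => k * complex.Re (c y) + (- l) * complex.Im (c y)).
  by apply/funext => y; case: (c y) => ? ? /=; ring.
have -> : (fun y => complex.Im ((k +i* l) * c y)) =
    (fun y => l * complex.Re (c y) + k * complex.Im (c y)).
  by apply/funext => y; case: (c y) => ? ? /=; ring.
rewrite !derive_comb //.
by apply/eqP; rewrite eq_complex /=; apply/andP; split; apply/eqP; ring.
Qed.

Lemma d_zbarZ (k : R[i]) c z :
  differentiable (fun y => complex.Re (c y)) z ->
  differentiable (fun y => complex.Im (c y)) z ->
  d_zbar (fun y => k * c y) z = k * d_zbar c z.
Proof. by move=> d1 d2; rewrite /d_zbar !cpartialZ //; ring. Qed.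

Lemma d_zbar_spinor Om a b z : csmooth Om a -> csmooth Om b -> Om z ->
  let u := d_zbar_vec (spinor a b) z in
  (u (inord 0) 0 = 2%:R^-1 * d_zbar a z) *
  (u (inord 1) 0 = 2%:R^-1 * d_zbar b z) *
  (u (inord 2) 0 = 2%:R^-1 * - iC R * d_zbar a z) *
  (u (inord 3) 0 = 2%:R^-1 * iC R * d_zbar b z).
Proof.
move=> [sa1 sa2] [sb1 sb2] Oz u.
have [a1 a2] := (smooth_diff sa1 Oz, smooth_diff sa2 Oz).
have [b1 b2] := (smooth_diff sb1 Oz, smooth_diff sb2 Oz).
have uE k : u k 0 = d_zbar (fun y => spinor a b y k 0) z by rewrite mxE.
rewrite !uE.
have -> : (fun y => spinor a b y (inord 0) 0) = (fun y => 2%:R^-1 * a y).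
  by apply/funext => y; rewrite spinorE.
have -> : (fun y => spinor a b y (inord 1) 0) = (fun y => 2%:R^-1 * b y).
  by apply/funext => y; rewrite spinorE.
have -> : (fun y => spinor a b y (inord 2) 0) = (fun y => 2%:R^-1 * - iC R * a y).
  by apply/funext => y; rewrite spinorE.
have -> : (fun y => spinor a b y (inord 3) 0) = (fun y => 2%:R^-1 * iC R * b y).
  by apply/funext => y; rewrite spinorE.
by rewrite !d_zbarZ.
Qed.

(** Both sides of the Dirac equation lie in the span of epsilon and Li
    epsilon-bar, so it amounts to two complex equations. *)
Lemma dirac_components Om beta a b z :
  csmooth Om a -> csmooth Om b -> Om z ->
  let k := 2%:R^-1 * d_z (fun y => (beta y)%:C) z in
  d_zbar_vec (spinor a b) z = k *: (Li R[i] *m conj_vec (spinor a b z)) <->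
  d_zbar a z = - k * conjc (b z) /\ d_zbar b z = k * conjc (a z).
Proof.
move=> sa sb Oz k.
have D := d_zbar_spinor sa sb Oz; move: D => /= D.
have RE j : (k *: (Li R[i] *m conj_vec (spinor a b z))) j 0 =
    k * (Li R[i] *m conj_vec (spinor a b z)) j 0 by rewrite [LHS]mxE.
have CE j : conj_vec (spinor a b z) j 0 = conjc (spinor a b z j 0) by rewrite [LHS]mxE.
have two0 : (2%:R : R[i]) != 0 by rewrite pnatr_eq0.
have ch : conjc (2%:R^-1 : R[i]) = 2%:R^-1.
  by rewrite half_complex; apply/eqP; rewrite eq_complex /= oppr0 !eqxx.
have cM (x y : R[i]) : conjc (x * y) = conjc x * conjc y by exact: rmorphM.
have cN (x : R[i]) : conjc (- x) = - conjc x by exact: rmorphN.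
have ci : conjc (iC R) = - iC R.
  by rewrite /iC /conjc; apply/eqP; rewrite eq_complex /= oppr0 !eqxx.
split=> [E|[Ea Eb]].
  have E0 := congr1 (fun u : 'cV[R[i]]_4 => u (inord 0) 0) E.
  have E1 := congr1 (fun u : 'cV[R[i]]_4 => u (inord 1) 0) E.
  rewrite /= !D RE mul_LiE CE spinorE cM ch in E0.
  rewrite /= !D RE mul_LiE CE spinorE cM ch in E1.
  split; apply: (mulfI (invr_neq0 two0)); rewrite ?E0 ?E1; ring.
apply: eq_cV4; rewrite !D RE mul_LiE CE spinorE !cM ?cN ch ?ci ?Ea ?Eb; ring.
Qed.

Lemma dirac_frame Om beta a b z : open Om ->
  csmooth Om a -> csmooth Om b -> Om z ->
  d_zbar_vec (spinor a b) z = (2%:R^-1 * d_z (fun y => (beta y)%:C) z)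
    *: (Li R[i] *m conj_vec (spinor a b z)) <->
  real_dirac beta (frame a b) z.
Proof.
move=> oOm sa sb Oz; apply: iff_trans (dirac_components beta sa sb Oz) _.
have sF := csmooth_frame oOm sa sb.
have dF := smooth_diff sF Oz.
have DF v : 'D_v (frame a b) z = cvec4 ('D_v (fun y => complex.Re (a y)) z)
    ('D_v (fun y => complex.Re (b y)) z) ('D_v (fun y => complex.Im (a y)) z)
    (- 'D_v (fun y => complex.Im (b y)) z).
  apply: eq_cV4; rewrite cvec4E -derive_coord //.
  - by congr (derive _ z v); apply/funext => y; rewrite cvec4E.
  - by congr (derive _ z v); apply/funext => y; rewrite cvec4E.
  - by congr (derive _ z v); apply/funext => y; rewrite cvec4E.
  - rewrite -derive_fN; last by case: sb => _ sb2; exact: smooth_diff sb2 Oz.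
    by congr (derive _ z v); apply/funext => y; rewrite cvec4E.
rewrite /real_dirac /d_z /d_zbar /cpartial !DF /= half_complex /iC.
have D0 v : 'D_v (fun _ : R * R => 0 : R) z = 0 by exact: derive_cst.
rewrite !D0.
move: ('D_(e_x R) beta z) ('D_(e_y R) beta z) => bx by'.
move: ('D_(e_x R) (fun y => complex.Re (a y)) z) => a1x.
move: ('D_(e_y R) (fun y => complex.Re (a y)) z) => a1y.
move: ('D_(e_x R) (fun y => complex.Im (a y)) z) => a2x.
move: ('D_(e_y R) (fun y => complex.Im (a y)) z) => a2y.
move: ('D_(e_x R) (fun y => complex.Re (b y)) z) => b1x.
move: ('D_(e_y R) (fun y => complex.Re (b y)) z) => b1y.
move: ('D_(e_x R) (fun y => complex.Im (b y)) z) => b2x.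
move: ('D_(e_y R) (fun y => complex.Im (b y)) z) => b2y.
have vE (p q : 'cV[R]_4) (r : R) k : (p + r *: q) k 0 = p k 0 + r * q k 0.
  by rewrite [LHS]mxE [X in _ + X]mxE.
rewrite /frame; case: (a z) => a1 a2; case: (b z) => b1 b2 /=.
split.
  move=> [/eqP + /eqP]; rewrite !eq_complex /=.
  move=> /andP[/eqP e1 /eqP e2] /andP[/eqP e3 /eqP e4].
  by apply: eq_cV4; rewrite !vE !(mul_LiE, JE, cvec4E); lra.
move=> E; have Ek k := congr1 (fun u : 'cV[R]_4 => u k 0) E.
have := (Ek (inord 0), Ek (inord 1), Ek (inord 2), Ek (inord 3)).
rewrite /= !vE !(mul_LiE, JE, cvec4E) => -[[[e0 e1] e2] e3].
by split; apply/eqP; rewrite eq_complex /=; apply/andP; split; apply/eqP; lra.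
Qed.

Lemma dirac_equation_frame Om beta a b : open Om ->
  csmooth Om a -> csmooth Om b ->
  dirac_equation Om beta (spinor a b) <->
  forall z, Om z -> real_dirac beta (frame a b) z.
Proof.
by move=> oOm sa sb; split=> H z Oz; apply/(dirac_frame beta oOm sa sb Oz); exact: H.
Qed.

(** From right to left, the Dirac equation comes from the symmetry of the second
    derivatives of X. The right-hand side is linear in the pair (X, P). *)
Lemma weakly_conformal_solutionP Om X beta : open Om ->
  weakly_conformal_solution Om X beta <->
  [/\ harmonic_on Om beta, smooth Om X & exists P, smooth Om P /\
    forall z, Om z -> frame_eq beta P X z].
Proof.
move=> oOm; split=> [[hb sX [a [b [sa sb _ /dX_equation_frame fX]]]]|].
  by split=> //; exists (frame a b); split=> //; exact: csmooth_frame.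
move=> [hb sX [P [sP fX]]]; split=> //.
have [a [b [sa sb E]]] := frame_surjective oOm sP; exists a, b.
have /funext EP : frame a b =1 P by exact: E.
split=> //; last by apply/dX_equation_frame; rewrite EP.
apply/(dirac_equation_frame beta oOm sa sb); rewrite EP.
by have [sb' _] := hb; exact: frame_eq_dirac sb' sP sX fX.
Qed.

End ComplexNotation.

(** * Geometry of maps with a frame *)

Section FrameGeometry.
Context {R : realType}.
Implicit Types (Om : set (R * R)) (z v h : R * R) (f beta : R * R -> R).
Implicit Types (P X : R * R -> 'cV[R]_4) (p q : 'cV[R]_4).

Lemma diff_partials {W : normedModType R} (X : R * R -> W) z h : differentiable X z ->
  'd X z h = h.1 *: 'D_(@e_x R) X z + h.2 *: 'D_(@e_y R) X z.
Proof.
move=> dX; rewrite !deriveE // -!linearZ -linearD; congr ('d X z _).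
by case: h => h1 h2; congr pair; rewrite /= /GRing.scale /= ?mulr1 ?mulr0 ?add0r ?addr0.
Qed.

Lemma frame_eq_rotLi beta P X z h : frame_eq beta P X z ->
  'd X z h = rotLi (beta z / 2) (h.1 *: P z + h.2 *: J (P z)).
Proof. by move=> /(_ h) ->; rewrite [RHS]linearD !linearZ. Qed.

Lemma frame_eq_angle beta P X z : differentiable X z -> frame_eq beta P X z ->
  'D_(@e_y R) X z = rotLi (beta z) (J ('D_(@e_x R) X z)).
Proof.
move=> dX fX; have [-> ->] := frame_eq_derive dX fX.
by rewrite J_rotLi rotLiD; congr rotLi; field.
Qed.

Lemma linear_combE p q (k l : R) (j : 'I_4) :
  (k *: p + l *: q) j 0 = k * p j 0 + l * q j 0.
Proof. by rewrite [LHS]mxE [X in X + _]mxE [X in _ + X]mxE. Qed.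

Lemma omega_rotLi t p q : omega (rotLi t p) (rotLi t q) = omega p q.
Proof.
rewrite /omega /wedge_form /x1 /x2 /x3 /x4 !rotLiE.
by rewrite -[RHS]mul1r -(cosMcosDsinMsin t); ring.
Qed.

Lemma frame_eq_isotropic beta P X z : frame_eq beta P X z -> isotropic_at X z.
Proof.
move=> fX h k; rewrite !(frame_eq_rotLi _ fX) omega_rotLi.
by rewrite /omega /wedge_form /x1 /x2 /x3 /x4 !linear_combE !JE; ring.
Qed.

(** P z and J (P z) are orthogonal of the same length, so the differential
    multiplies all lengths by it. *)
Lemma frame_eq_immersive beta P X z : frame_eq beta P X z -> P z <> 0 ->
  immersive_at X z.
Proof.
move=> fX P0 h k E; apply/subr0_eq.
have : 'd X z (h - k) = 0 by rewrite linearB E subrr.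
rewrite (frame_eq_rotLi _ fX); case: (h - k) => u v /= E0.
have : inner (rotLi (beta z / 2) (u *: P z + v *: J (P z)))
             (rotLi (beta z / 2) (u *: P z + v *: J (P z))) = 0.
  by rewrite E0 innerE /x1 /x2 /x3 /x4 !mxE; ring.
rewrite inner_rotLi.
have -> : inner (u *: P z + v *: J (P z)) (u *: P z + v *: J (P z)) =
    (u ^+ 2 + v ^+ 2) * inner (P z) (P z).
  by rewrite !innerE /x1 /x2 /x3 /x4 !linear_combE !JE; ring.
move=> /eqP; rewrite mulf_eq0 => /orP[|/eqP /inner_eq0 //].
by rewrite paddr_eq0 ?sqr_ge0 // !sqrf_eq0 => /andP[/eqP -> /eqP ->].
Qed.

Lemma frame0_spinor (a b : R * R -> R[i]) z : frame a b z = 0 -> spinor a b z = 0.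
Proof.
move=> F0; have Fk k : frame a b z k 0 = 0 by rewrite F0 mxE.
have := (Fk (inord 0), Fk (inord 1), Fk (inord 2), Fk (inord 3)).
rewrite /frame !cvec4E => -[[[a1 b1] a2] /eqP]; rewrite oppr_eq0 => /eqP b2.
have a0 : a z = 0 by apply/eqP; rewrite eq_complex /= a1 a2 !eqxx.
have b0 : b z = 0 by apply/eqP; rewrite eq_complex /= b1 b2 !eqxx.
by rewrite /spinor a0 b0 !scale0r addr0.
Qed.

Lemma frame_eq_HSL Om beta P X : smooth Om X -> harmonic_on Om beta ->
  (forall z, Om z -> frame_eq beta P X z) -> weakly_conformal_HSL Om X beta.
Proof.
move=> sX hb fX; split; [exact: sX|exact: hb|] => z Oz.
have dX := smooth_diff sX Oz.
rewrite (frame_eq_angle dX (fX z Oz)).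
have [E1 E2 E3 E4] := angle_of_frame ('D_(@e_x R) X z) (beta z).
split; [by rewrite E1|exact: E2|exact: frame_eq_isotropic (fX z Oz)|].
by rewrite E4 E1 enormM.
Qed.

Lemma hol_volumeZ (k l : R) p q :
  hol_volume (k *: p) (l *: q) = real_complex R (k * l) * hol_volume p q.
Proof.
rewrite /hol_volume /wedge_form /x1 /x2 /x3 /x4 !mxE.
by apply/eqP; rewrite eq_complex /=; apply/andP; split; apply/eqP; ring.
Qed.

Lemma real_complexM (k l : R) :
  real_complex R k * real_complex R l = real_complex R (k * l).
Proof. by apply/eqP; rewrite eq_complex /= !(mulr0, mul0r, subr0, addr0) !eqxx. Qed.

Lemma enorm_gt0 p : p <> 0 -> 0 < enorm p.
Proof.
move=> p0; rewrite sqrtr_gt0 lt_neqAle inner_ge0 andbT eq_sym.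
by apply/eqP => /inner_eq0.
Qed.

Lemma frame_eq_conformal Om beta P X : smooth Om X -> harmonic_on Om beta ->
  (forall z, Om z -> frame_eq beta P X z) -> (forall z, Om z -> P z <> 0) ->
  exists f, [/\ conformal_Lagrangian_immersion Om X f,
    Hamiltonian_stationary Om X f & Lagrangian_angle Om X f beta].
Proof.
move=> sX hb fX P0; pose f z := ln (enorm ('D_(@e_x R) X z)).
have [_ _ H] := frame_eq_HSL sX hb fX.
have Xx0 z : Om z -> 0 < enorm ('D_(@e_x R) X z).
  move=> Oz; apply: enorm_gt0 => E.
  have := (frame_eq_derive (smooth_diff sX Oz) (fX z Oz)).1; rewrite E => E'.
  apply: (P0 z Oz); rewrite -(rotLi0 (P z)) -(addNr (beta z / 2)) -rotLiD -E'.
  exact: linear0.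
have ef z : Om z -> expR (f z) = enorm ('D_(@e_x R) X z).
  by move=> Oz; rewrite /f lnK // posrE Xx0.
have aX : Lagrangian_angle Om X f beta.
  split; first by case: hb.
  move=> z Oz; have [nX _ _ volX] := H z Oz.
  rewrite hol_volumeZ volX -nX -(ef z Oz) expRN mulrA real_complexM.
  have -> : (expR (f z))^-1 * (expR (f z))^-1 * (expR (f z) * expR (f z)) = 1.
    by field; rewrite gt_eqF ?expR_gt0.
  by rewrite mul1r.
exists f; split; [|by exists beta|exact: aX].
split; [exact: sX|] => z Oz; have [nX iX oX _] := H z Oz; split.
- exact: frame_eq_immersive (fX z Oz) (P0 z Oz).
- exact: esym (ef z Oz).
- exact: etrans (esym nX) (esym (ef z Oz)).
- exact: iX.
- exact: oX.
Qed.

(** By frame_from_angle X_y is rotLi beta (J X_x). Half of that rotation can be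
    moved to X_x, because J (rotLi t p) is rotLi (- t) (J p). *)
Lemma Lagrangian_angle_frame Om X f beta : open Om ->
  conformal_Lagrangian_immersion Om X f -> Lagrangian_angle Om X f beta ->
  exists P, smooth Om P /\ forall z, Om z -> frame_eq beta P X z.
Proof.
move=> oOm [sX H] [sb aX].
exists (fun z => rotLi (- (beta z / 2)) ('D_(@e_x R) X z)); split.
  apply: smooth_rotLi => //; last exact: smooth_derive.
  by apply: smoothN => //; exact: smooth_half.
move=> z Oz h; have [_ nx ny _ _] := H z Oz.
rewrite diff_partials; last exact: smooth_diff sX Oz.
have -> : 'D_(@e_y R) X z = rotLi (beta z) (J ('D_(@e_x R) X z)).
  apply: frame_from_angle; first by rewrite nx ny.
  have := aX z Oz; rewrite hol_volumeZ nx ny => <-.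
  rewrite expRN mulrA real_complexM.
  have -> : expR (f z) * expR (f z) * ((expR (f z))^-1 * (expR (f z))^-1) = 1.
    by field; rewrite gt_eqF ?expR_gt0.
  by rewrite mul1r.
rewrite J_rotLi !rotLiD subrr rotLi0 opprK.
by congr (_ + _ *: rotLi _ _); field.
Qed.

(** The two functions differ by a multiple of 2 pi at each point. Differentiating
    both cos and sin shows that their differentials agree, since cos and sin have
    no common zero. *)
Lemma expi_derive Om beta beta' z v : open Om -> smooth Om beta ->
  smooth Om beta' -> (forall z, Om z -> expi (beta z) = expi (beta' z)) ->
  Om z -> 'D_v beta z = 'D_v beta' z.
Proof.
move=> oOm sb sb' E Oz.
have [db db'] := (smooth_diff sb Oz, smooth_diff sb' Oz).
have [cE sE] : (forall y, Om y -> cos (beta y) = cos (beta' y)) /\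
    (forall y, Om y -> sin (beta y) = sin (beta' y)).
  by split=> y Oy; have := E y Oy; rewrite /expi => -[].
have [_ c1] := derive_comp1 v (is_derive_cos (beta z)) db.
have [_ c2] := derive_comp1 v (is_derive_cos (beta' z)) db'.
have [_ s1] := derive_comp1 v (is_derive_sin (beta z)) db.
have [_ s2] := derive_comp1 v (is_derive_sin (beta' z)) db'.
have := derive_eq_on v oOm cE Oz; rewrite [LHS]c1 [RHS]c2 sE // => C.
have := derive_eq_on v oOm sE Oz; rewrite [LHS]s1 [RHS]s2 cE // => S.
rewrite -[LHS]mul1r -[RHS]mul1r -(cosMcosDsinMsin (beta' z)) !mulrDl -!mulrA S.
have -> : sin (beta' z) * 'D_v beta z = sin (beta' z) * 'D_v beta' z.
  by apply: oppr_inj; rewrite -!mulNr.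
by [].
Qed.

Lemma expi_harmonic Om beta beta' : open Om -> smooth Om beta ->
  (forall z, Om z -> expi (beta z) = expi (beta' z)) ->
  harmonic_on Om beta' -> harmonic_on Om beta.
Proof.
move=> oOm sb E [sb' hb']; split; [exact: sb|] => z Oz.
have D v y : Om y -> 'D_v beta y = 'D_v beta' y.
  by move=> Oy; exact: expi_derive sb sb' E Oy.
rewrite -(hb' z Oz) /laplacian.
rewrite (derive_eq_on (@e_x R) oOm (D (@e_x R)) Oz).
by rewrite (derive_eq_on (@e_y R) oOm (D (@e_y R)) Oz).
Qed.

Lemma immersion_spinor Om X f beta : open Om ->
  conformal_Lagrangian_immersion Om X f -> Hamiltonian_stationary Om X f ->
  Lagrangian_angle Om X f beta ->
  harmonic_on Om beta /\ exists a b : R * R -> R[i],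
    [/\ csmooth Om a, csmooth Om b, dirac_equation Om beta (spinor a b)
      & dX_equation Om X beta (spinor a b)].
Proof.
move=> oOm cX [beta' [_ aX'] hb'] aX; have [sb aX1] := aX.
have hb : harmonic_on Om beta.
  by apply: expi_harmonic hb' => // z Oz; rewrite -aX1 // -aX'.
split=> //; have [sX _] := cX; have [P [sP fX]] := Lagrangian_angle_frame oOm cX aX.
have [|_ _ [a [b [sa sb' da dX]]]] := (weakly_conformal_solutionP X beta oOm).2.
  by split=> //; exists P.
by exists a, b.
Qed.

End FrameGeometry.

(** * Unitary motions *)

Section UnitaryMotions.
Context {R : realType}.
Implicit Types (Om : set (R * R)) (z v h : R * R) (f beta : R * R -> R).
Implicit Types (P X Y : R * R -> 'cV[R]_4) (p q T : 'cV[R]_4) (G : 'M[R]_4).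

Lemma mulmxE4 G p i : (G *m p) i 0 = G i (inord 0) * p (inord 0) 0 +
  G i (inord 1) * p (inord 1) 0 + G i (inord 2) * p (inord 2) 0 +
  G i (inord 3) * p (inord 3) 0.
Proof. by rewrite mxE sum4. Qed.

Lemma derive_mulmx G T Y z v : differentiable Y z ->
  differentiable (fun y => G *m Y y + T) z /\
  'D_v (fun y => G *m Y y + T) z = G *m 'D_v Y z.
Proof.
move=> dY.
have dk k : differentiable (fun y => Y y k 0) z by exact: differentiable_mxcoord.
have comb (f g : R * R -> R) (k l : R) : differentiable f z -> differentiable g z ->
    differentiable (fun y => k * f y + l * g y) z.
  move=> df dg; apply: differentiableD;
    by apply: differentiableM => //; exact: differentiable_cst.
have E i : (fun y => (G *m Y y + T) i 0) = fun y =>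
    1 * (1 * (G i (inord 0) * Y y (inord 0) 0 + G i (inord 1) * Y y (inord 1) 0) +
    1 * (G i (inord 2) * Y y (inord 2) 0 + G i (inord 3) * Y y (inord 3) 0)) +
    T i 0 * 1.
  by apply/funext => y; rewrite [LHS]mxE mulmxE4; ring.
have d1 : differentiable (fun _ : R * R => 1 : R) z by exact: differentiable_cst.
have e01 i := comb _ _ (G i (inord 0)) (G i (inord 1)) (dk (inord 0)) (dk (inord 1)).
have e23 i := comb _ _ (G i (inord 2)) (G i (inord 3)) (dk (inord 2)) (dk (inord 3)).
have e4 i := comb _ _ 1 1 (e01 i) (e23 i).
have e5 i := comb _ _ 1 (T i 0) (e4 i) d1.
have dE i : differentiable (fun y => (G *m Y y + T) i 0) z by rewrite E; exact: e5.
have dG := differentiable_cV dE; split=> //.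
have D i : ('D_v (fun y => G *m Y y + T) z) i 0 = (G *m 'D_v Y z) i 0.
  have Dk k := derive_coord k 0 v dY.
  rewrite -(derive_coord i 0 v dG) E (derive_comb _ _ v (e4 i) d1).
  rewrite (derive_comb _ _ v (e01 i) (e23 i)) (derive_comb _ _ v (dk _) (dk _)).
  rewrite (derive_comb _ _ v (dk _) (dk _)) !Dk mulmxE4.
  by rewrite [X in _ + _ * X]derive_cst; ring.
by apply: eq_cV4; exact: D.
Qed.

Lemma smooth_mulmx Om G T Y : open Om -> smooth Om Y ->
  smooth Om (fun z => G *m Y z + T).
Proof.
move=> oOm sY; apply: smooth_cV => // i.
have sk k := smoothM oOm (smooth_cst Om (G i k : R)) (smooth_coord k 0 oOm sY).
have := smoothD oOm (smoothD oOm (smoothD oOm (smoothD oOm (sk (inord 0))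
  (sk (inord 1))) (sk (inord 2))) (sk (inord 3))) (smooth_cst Om (T i 0 : R)).
by apply: smooth_eq => // z _; rewrite [RHS]mxE mulmxE4.
Qed.

Lemma Lagrange_hol_volume p q :
  complex.Re (hol_volume p q) ^+ 2 + complex.Im (hol_volume p q) ^+ 2 =
  inner p p * inner q q - inner p q ^+ 2 - omega p q ^+ 2.
Proof.
rewrite !innerE /omega /hol_volume /wedge_form /=; ring.
Qed.

Lemma expi_surjective (x y : R) : x ^+ 2 + y ^+ 2 = 1 ->
  exists c, cos c = x /\ sin c = y.
Proof.
move=> xy.
have x1 : -1 <= x <= 1.
  rewrite -ler_norml -(@ler_pXn2r _ 2) ?nnegrE // expr1n real_normK ?num_real //.
  by rewrite -xy lerDl sqr_ge0.
have cx : cos (acos x) = x by rewrite acosK // in_itv.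
have sx : sin (acos x) = `|y|.
  rewrite sin_acos //; have -> : 1 - x ^+ 2 = y ^+ 2 by rewrite -xy addrAC subrr add0r.
  by rewrite sqrtr_sqr.
have [y0|y0] := leP 0 y.
  by exists (acos x); rewrite cx sx ger0_norm.
by exists (- acos x); rewrite cosN sinN cx sx ltr0_norm // opprK.
Qed.

Definition basis_vec (k : nat) : 'cV[R]_4 := delta_mx (inord k) 0.

Lemma inner_mulmx G p q : G^T *m G = 1%:M -> inner (G *m p) (G *m q) = inner p q.
Proof.
by move=> GG; rewrite /inner trmx_mul mulmxA -(mulmxA _ G^T) GG mulmx1.
Qed.

Lemma omega_inner p q : omega p q = inner (Li R *m p) q.
Proof.
by rewrite innerE /omega /wedge_form /x1 /x2 /x3 /x4 !mul_LiE; ring.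
Qed.

(** G multiplies holomorphic volumes by its complex determinant, which is of the
    form exp (i c). So (G p, G (J p)) is the frame of a Lagrangian plane of angle
    c, and frame_from_angle applies. *)
Lemma unitary_J G T : in_group G T ->
  exists c, forall p, G *m J p = rotLi c (J (G *m p)).
Proof.
move=> [GG _ GL].
(* G is complex linear, so it is determined on C^2 by two columns. *)
have Gp p : G *m p = x1 p *: (G *m basis_vec 0) + x2 p *: (Li R *m (G *m basis_vec 0)) +
    (x3 p *: (G *m basis_vec 2) + x4 p *: (Li R *m (G *m basis_vec 2))).
  have e : p = x1 p *: basis_vec 0 + x2 p *: (Li R *m basis_vec 0) +
      (x3 p *: basis_vec 2 + x4 p *: (Li R *m basis_vec 2)).
    apply: eq_cV4;
      rewrite [RHS]mxE !linear_combE !mul_LiE /basis_vec !mxE -!val_eqE /= !inordK //=;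
      by rewrite /x1 /x2 /x3 /x4; ring.
  by rewrite {1}e !mulmxDr -!scalemxAr !mulmxA GL.
set g := G *m basis_vec 0 in Gp; set k := G *m basis_vec 2 in Gp.
have volE p : hol_volume (G *m p) (G *m J p) =
    real_complex R (inner p p) * hol_volume g k.
  rewrite [G *m p]Gp [G *m J p]Gp innerE /hol_volume /wedge_form.
  rewrite /x1 /x2 /x3 /x4.
  have cE (q q' r r' : 'cV[R]_4) (m n m' n' : R) (j : 'I_4) :
      (m *: q + n *: q' + (m' *: r + n' *: r')) j 0 =
      m * q j 0 + n * q' j 0 + (m' * r j 0 + n' * r' j 0).
    by rewrite [LHS]mxE !linear_combE.
  rewrite !cE !mul_LiE !JE.
  by apply/eqP; rewrite eq_complex /=; apply/andP; split; apply/eqP; ring.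
have [c [cc sc]] : exists c, cos c = complex.Re (hol_volume g k) /\
    sin c = complex.Im (hol_volume g k).
  apply: expi_surjective; rewrite Lagrange_hol_volume omega_inner /g /k.
  rewrite mulmxA -GL -mulmxA !inner_mulmx // !innerE /x1 /x2 /x3 /x4 !mul_LiE /basis_vec.
  by rewrite !mxE -!val_eqE /= !inordK //=; ring.
exists c => p; apply: frame_from_angle.
  by rewrite /enorm !inner_mulmx // inner_J.
rewrite volE /enorm !inner_mulmx // inner_J -/(enorm p) enormM; congr (_ * _).
by apply/eqP; rewrite eq_complex /expi /= cc sc !eqxx.
Qed.

Lemma eq_mulmx (A B : 'M[R]_4) : (forall p, A *m p = B *m p) -> A = B.
Proof.
move=> AB; apply/matrixP => i j.
have := congr1 (fun u : 'cV[R]_4 => u i 0) (AB (delta_mx j 0)).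
by rewrite /= -!colE !mxE.
Qed.

Lemma rotmxD (s t : R) : rotmx s *m rotmx t = rotmx (s + t).
Proof. by apply: eq_mulmx => p; rewrite -mulmxA !mul_rotmx rotLiD. Qed.

Lemma tr_Li : (Li R)^T = - Li R.
Proof.
apply/matrixP => i j; rewrite !mxE.
by case: i j => [[|[|[|[|//]]]] ?] [[|[|[|[|//]]]] ?]; rewrite /= ?oppr0 ?opprK.
Qed.

Lemma rotmx_in_group (t : R) : in_group (rotmx t) 0.
Proof.
have tr (s : R) : (rotmx s)^T = rotmx (- s).
  by rewrite /rotmx linearD linearZ /= tr_scalar_mx tr_Li cosN sinN scaleNr scalerN.
have orth (s : R) : (rotmx s)^T *m rotmx s = 1%:M.
  by rewrite tr rotmxD addNr /rotmx cos0 sin0 scale0r addr0.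
split=> //; last by rewrite /rotmx mulmxDl mulmxDr scalar_mxC -scalemxAl -scalemxAr.
(* The rotation is the square of an orthogonal matrix. *)
have -> : t = t / 2 + t / 2 by rewrite -splitr.
rewrite -rotmxD det_mulmx.
by have := congr1 determinant (orth (t / 2)); rewrite det_mulmx det_tr det1.
Qed.

Lemma harmonicD Om beta c : open Om -> harmonic_on Om beta ->
  harmonic_on Om (fun z => beta z + c).
Proof.
move=> oOm [sb hb]; split.
  exact: smoothD oOm sb (smooth_cst Om c).
have D v z : Om z -> 'D_v (fun z => beta z + c) z = 'D_v beta z.
  move=> Oz; rewrite derive_fD; last exact: differentiable_cst.
    by rewrite [X in _ + X]derive_cst addr0.
  exact: smooth_diff sb Oz.
move=> z Oz; rewrite -(hb z Oz) /laplacian.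
rewrite (derive_eq_on (@e_x R) oOm (D (@e_x R)) Oz).
by rewrite (derive_eq_on (@e_y R) oOm (D (@e_y R)) Oz).
Qed.

End UnitaryMotions.

(** * The space of solutions *)

Section SolutionSpace.
Context {R : realType}.
Implicit Types (Om : set (R * R)) (z v h : R * R) (f beta : R * R -> R).
Implicit Types (P X Y : R * R -> 'cV[R]_4) (p q T : 'cV[R]_4) (G : 'M[R]_4).

Lemma diff_derive_on Om X Y z h : open Om -> smooth Om X -> smooth Om Y ->
  (forall z, Om z -> X z = Y z) -> Om z -> 'd X z h = 'd Y z h.
Proof.
move=> oOm sX sY XY Oz.
have [dX dY] := (smooth_diff sX Oz, smooth_diff sY Oz).
apply: etrans (esym (deriveE h dX)) _; apply: etrans (deriveE h dY).
exact: derive_eq_on oOm XY Oz.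
Qed.

Lemma diff_mulmx G T Y z h : differentiable Y z ->
  'd (fun y => G *m Y y + T) z h = G *m 'd Y z h.
Proof.
move=> dY; have [dG DG] := derive_mulmx G T h dY.
apply: etrans (esym (deriveE h dG)) _; rewrite DG; congr (_ *m _).
exact: deriveE.
Qed.

(** G is the rotation by c / 2 after a map A commuting with Li and, by
    unitary_J, with J, where exp (i c) is the complex determinant of G. The map
    A carries the frame P to A P, and the rotation shifts the angle by c. *)
Lemma solution_motion Om beta Y G T X : open Om ->
  weakly_conformal_solution Om Y beta -> in_group G T ->
  (forall z, Om z -> X z = G *m Y z + T) ->
  exists c, weakly_conformal_solution Om X (fun z => beta z + c).
Proof.
move=> oOm sol GT XY.
have [hb sY [P [sP fY]]] := (weakly_conformal_solutionP Y beta oOm).1 sol.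
have [c GJ] := unitary_J GT; have [_ _ GL] := GT.
exists c; apply/(weakly_conformal_solutionP _ _ oOm).
have sGY := smooth_mulmx G T oOm sY.
have sX : smooth Om X by apply: smooth_eq sGY => // z Oz; rewrite XY.
split; [exact: harmonicD|exact: sX|].
pose A := rotmx (- (c / 2)) *m G.
exists (fun z => A *m P z + 0); split; first exact: smooth_mulmx.
move=> z Oz h; rewrite (diff_derive_on h oOm sX sGY XY Oz).
have dY := smooth_diff sY Oz; rewrite (diff_mulmx G T h dY) fY //.
have GLp p : G *m (Li R *m p) = Li R *m (G *m p) by rewrite !mulmxA GL.
have Grot t p : G *m rotLi t p = rotLi t (G *m p).
  by rewrite /rotLi mulmxDr -!scalemxAr GLp.
rewrite mulmxDr -!scalemxAr !Grot GJ !addr0 /A -!mulmxA !mul_rotmx J_rotLi !rotLiD.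
by congr (_ *: rotLi _ _ + _ *: rotLi _ _); field.
Qed.

(** The rotation cancels the shift of the angle, for the same frame. *)
Lemma solution_rotate Om beta c X : open Om -> harmonic_on Om beta ->
  weakly_conformal_solution Om X (fun z => beta z + c) ->
  weakly_conformal_solution Om (fun z => rotmx (- (c / 2)) *m X z + 0) beta.
Proof.
move=> oOm hb /(weakly_conformal_solutionP _ _ oOm)[_ sX [P [sP fX]]].
apply/(weakly_conformal_solutionP _ _ oOm); split; [exact: hb|exact: smooth_mulmx|].
exists P; split=> // z Oz h; have dX := smooth_diff sX Oz.
rewrite (diff_mulmx _ _ h dX) fX // mulmxDr -!scalemxAr !mul_rotmx !rotLiD.
by congr (_ *: rotLi _ _ + _ *: rotLi _ _); field.
Qed.

Lemma solution_comb Om beta X Y (k : R) : open Om ->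
  weakly_conformal_solution Om X beta -> weakly_conformal_solution Om Y beta ->
  weakly_conformal_solution Om (fun z => k *: X z + Y z) beta.
Proof.
move=> oOm /(weakly_conformal_solutionP _ _ oOm)[hb sX [P [sP fX]]].
move=> /(weakly_conformal_solutionP _ _ oOm)[_ sY [Q [sQ fY]]].
have sc (A B : R * R -> 'cV[R]_4) : smooth Om A -> smooth Om B ->
    smooth Om (fun z => k *: A z + B z).
  move=> sA sB; have := smoothD oOm (smooth_mulmx k%:M 0 oOm sA) sB.
  by apply: smooth_eq => // z _; rewrite addr0 mul_scalar_mx.
apply/(weakly_conformal_solutionP _ _ oOm); split; [exact: hb|exact: sc|].
exists (fun z => k *: P z + Q z); split; first exact: sc.
move=> z Oz h; have [dX dY] := (smooth_diff sX Oz, smooth_diff sY Oz).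
have -> : 'd (fun z => k *: X z + Y z) z h = k *: 'd X z h + 'd Y z h.
  have dkX : differentiable (k *: X) z by exact: differentiableZ.
  have DkX := congr1 (fun F : R * R -> 'cV[R]_4 => F h) (diffZ k dX).
  have DS := congr1 (fun F : R * R -> 'cV[R]_4 => F h) (diffD dkX dY).
  by apply: etrans DS _; apply: congr2 DkX _.
have rL t p q : rotLi t (k *: p + q) = k *: rotLi t p + rotLi t q by exact: rotLi_linear.
have JL p q : J (k *: p + q) = k *: J p + J q by exact: J_linear.
apply: etrans (congr2 +%R (congr1 ( *:%R k) (fX z Oz h)) (fY z Oz h)) _.
rewrite JL (rL _ (P z)) (rL _ (J (P z))).
move: (rotLi _ (P z)) (rotLi _ (Q z)) (rotLi _ (J (P z))) (rotLi _ (J (Q z))).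
move=> A B C D; rewrite !scalerDr !scalerA addrACA.
by rewrite [h.1 * k]mulrC [h.2 * k]mulrC.
Qed.

Lemma solution0 Om beta : open Om -> harmonic_on Om beta ->
  weakly_conformal_solution Om (fun=> 0) beta.
Proof.
move=> oOm hb; apply/(weakly_conformal_solutionP _ _ oOm).
split; [exact: hb|exact: smooth_cst|].
exists (fun=> 0); split; first exact: smooth_cst.
move=> z Oz h; rewrite -deriveE; last exact: differentiable_cst.
have J0 : J (0 : 'cV[R]_4) = 0 by exact: linear0.
have r0 t : rotLi t (0 : 'cV[R]_4) = 0 by exact: linear0.
by apply: etrans (derive_cst _ _ _) _; rewrite J0 r0 !scaler0 addr0.
Qed.

End SolutionSpace.

Unset Implicit Arguments.

Theorem theorem3 (R : realType) (Om : set (R * R))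
    (hOm : simply_connected_domain Om) :
  [/\ (forall (X : R * R -> 'cV[R]_4) (f beta : R * R -> R),
        conformal_Lagrangian_immersion Om X f ->
        Hamiltonian_stationary Om X f ->
        Lagrangian_angle Om X f beta ->
        harmonic_on Om beta /\
        exists a b : R * R -> R[i],
          [/\ csmooth Om a, csmooth Om b,
              dirac_equation Om beta (spinor a b)
            & dX_equation Om X beta (spinor a b)]),
      (forall (beta : R * R -> R) (a b : R * R -> R[i]),
        harmonic_on Om beta -> csmooth Om a -> csmooth Om b ->
        dirac_equation Om beta (spinor a b) ->
        (exists X : R * R -> 'cV[R]_4,
          smooth Om X /\ dX_equation Om X beta (spinor a b)) /\
        (forall X : R * R -> 'cV[R]_4,
          smooth Om X -> dX_equation Om X beta (spinor a b) ->
          [/\ weakly_conformal_HSL Om X beta,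
              (forall z, Om z -> spinor a b z <> 0 -> immersive_at X z)
            & exists f : R * R -> R,
                let U := Om `&` [set z | spinor a b z <> 0] in
                [/\ conformal_Lagrangian_immersion U X f,
                    Hamiltonian_stationary U X f
                  & Lagrangian_angle U X f beta]]))
    & (forall beta : R * R -> R, harmonic_on Om beta ->
        exists2 V : {pred (Om -> 'cV[R]_4)}, submod_closed V &
          forall X : R * R -> 'cV[R]_4,
            (exists c : R,
               weakly_conformal_solution Om X (fun z => beta z + c)) <->
            (exists (G : 'M[R]_4) (T : 'cV[R]_4) (Y : Om -> 'cV[R]_4),
               [/\ in_group G T, Y \in V
                 & forall z : Om, X (val z) = G *m Y z + T]))].
Proof.
have [oOm _ _ _] := hOm; split.
- by move=> X f beta; exact: immersion_spinor.
- move=> beta a b hb sa sb da; have [sbeta _] := hb.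
  have sF := csmooth_frame oOm sa sb.
  have dF := (dirac_equation_frame beta oOm sa sb).1 da; split.
    have [X [sX fX]] := frame_integrable hOm sbeta sF dF; exists X; split=> //.
    exact/dX_equation_frame.
  move=> X sX /dX_equation_frame fX.
  have F0 z : spinor a b z <> 0 -> frame a b z <> 0.
    by move=> u0 /frame0_spinor.
  split; first exact: frame_eq_HSL hb fX.
    by move=> z Oz /F0; exact: frame_eq_immersive (fX z Oz).
  pose U := Om `&` [set z | spinor a b z <> 0].
  have UO : U `<=` Om by move=> z [].
  apply: (@frame_eq_conformal _ U beta (frame a b)).
  + exact: smooth_subset sX.
  + by split; [exact: smooth_subset sbeta|move=> z /UO; case: hb => _; apply].
  + by move=> z /UO; exact: fX.
  + by move=> z [_ /F0].
- move=> beta hb.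
  pose V : {pred (Om -> 'cV[R]_4)} := fun Y => `[< exists Y',
    weakly_conformal_solution Om Y' beta /\ forall z : Om, Y z = Y' (val z) >].
  exists V.
    split; first by apply/asboolP; exists (fun=> 0); split=> //; exact: solution0.
    move=> k Y1 Y2 /asboolP[Y1' [s1 E1]] /asboolP[Y2' [s2 E2]].
    apply/asboolP; exists (fun z => k *: Y1' z + Y2' z); split.
      exact: solution_comb.
    by move=> z; rewrite -E1 -E2.
  move=> X; split.
    move=> [c /(solution_rotate oOm hb) sol].
    exists (rotmx (c / 2)), 0, (fun z : Om => rotmx (- (c / 2)) *m X (val z) + 0).
    split; first exact: rotmx_in_group.
      by apply/asboolP; exists (fun z => rotmx (- (c / 2)) *m X z + 0).
    by move=> z; rewrite !addr0 !mul_rotmx rotLiD subrr rotLi0.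
  move=> [G [T [Y [GT /asboolP[Y' [sol E]] XY]]]].
  apply: (solution_motion oOm sol GT) => z Oz.
  have Oz' : z \in Om by exact: mem_set.
  by rewrite -(E (SigSub Oz')) -XY.
Qed.
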